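(* Let $\mathcal S\subseteq\omega_1$ be stationary, let $T$ be an $\omega_1$-tree and let $Y\subseteq T$. Let $\mathbb P$ be a notion of forcing such that $\mathrm{Pr}^2_{\mathcal S}(\mathbb P)$ holds (with $\alpha(\ast)=\omega_1$). Then $\mathbb P$ is $(T,Y,\mathcal S)$-preserving.
   Context: In forcing notions $q\ge p$ means $q$ is stronger than $p$. $\mathcal H(\chi)=(H(\chi),\in,<^*_\chi)$, where $H(\chi)$ is the set of sets of hereditary cardinality $<\chi$ and $<^*_\chi$ is a well-order of it; $\chi$ is a sufficiently large regular cardinal. $\dot G$ is the name of the generic filter. The game. Let $N\prec\mathcal H(\chi)$ be countable with $\mathbb P\in N$, $p\in\mathbb P\cap N$. The game $\Game^2(N,\mathbb P,p)$ is played in $\omega$ rounds by COM and INC. In round $n$, COM chooses $\ell_n\in\omega\setminus\{0\}$ and a sequence $\langle p_{n,\ell}:\ell<\ell_n\rangle$ of conditions in $\mathbb P$; then INC plays $\langle q_{n,\ell}:\ell<\ell_n\rangle$ with $q_{n,\ell}\in\mathbb P$ and $p_{n,\ell}\le q_{n,\ell}$. Every initial segment of the play is required to be in $N$. After $\omega$ rounds COM wins iff for every infinite $u\subseteq\omega$ there is $q_u\in\mathbb P$, $q_u\ge p$, such that $q_u\Vdash(\exists^\infty n\in u)(\exists\ell<\ell_n)(q_{n,\ell}\in\dot G)$. $\mathrm{Pr}^2_{\mathcal S}(\mathbb P)$ (with $\alpha(\ast)=\omega_1$): for every sufficiently large $\chi$, every countable $N\prec\mathcal H(\chi)$ with $\mathbb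 P\in N$ and $N\cap\omega_1\in\mathcal S$, and every $p\in\mathbb P\cap N$, COM has a winning strategy in $\Game^2(N,\mathbb P,p)$. Trees. An $\omega_1$-tree is a tree $(T,<_T)$ of size and height $\omega_1$ with at most countable levels; trees are required to be normal: for every $t$ on level $\alpha<\omega_1$ and every $\alpha<\beta<\omega_1$ there are two distinct nodes above $t$ on level $\beta$. $T_\delta$ is the $\delta$-th level, $Y(\delta)=Y\cap T_\delta$ (possibly empty). $T$ is also viewed as a forcing notion in which higher nodes are stronger. For a model $N$, the set $\{s: s<_T t\}$ is $(N,T)$-generic if it meets every dense subset of $T$ that belongs to $N$. A condition $q$ is $(N,\mathbb P)$-generic if $q\Vdash\dot G\cap D\cap N\neq\emptyset$ for every dense $D\subseteq\mathbb P$ with $D\in N$. $\mathbb P$ is $(T,Y,\mathcal S)$-preserving iff there is $x\in H(\chi)$ such that for every countable $N\prec\mathcal H(\chi)$ with $\{x,Y,T,\mathbb P,\mathcal S\}\subseteq N$ and every $p\in\mathbb P\cap N$: if $\delta=N\cap\omega_1\in\mathcal S$ and for every $t\in Y(\delta)$ the set $\{s:s<_Tt\}$ is $(N,T)$-generic, then there is $q\ge p$ such that $q$ is $(N,\mathbb P)$-generic and $q\Vdash_{\mathbb P}(\forall t\in Y(\delta))$ ($\{s:s<_Tt\}$ is $(N[\dot G],T)$-generic). *)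

(* Defs.v *)
From Stdlib Require Import List Arith Lia Relations Wellfounded.
From Stdlib Require Import Classical ClassicalEpsilon ProofIrrelevance.
From Stdlib Require Import FunctionalExtensionality PropExtensionality.
Import ListNotations.

Set Implicit Arguments.

(** * The universe of sets

    [V] is the quotient of Aczel's type of well-founded trees by bisimilarity.
    With classical logic and choice it is a model of ZFC in which Leibniz
    equality is extensional equality of sets. *)

Inductive Ens : Type := sup (A : Type) (f : A -> Ens).

Fixpoint eqv (x y : Ens) {struct x} : Prop :=
  match x, y with
  | sup f, sup g =>
      (forall a, exists b, eqv (f a) (g b)) /\ (forall b, exists a, eqv (f a) (g b))
  end.

Definition V : Type := {c : Ens -> Prop | exists x, c = eqv x}.

Definition cls (x : Ens) : V := exist _ (eqv x) (ex_intro _ x eq_refl).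

Definition repr (X : V) : Ens :=
  proj1_sig (constructive_indefinite_description _ (proj2_sig X)).

Definition ens_idx (x : Ens) : Type := match x with @sup A _ => A end.
Definition ens_fam (x : Ens) : ens_idx x -> Ens :=
  match x with @sup A f => f end.

(** Every set [x] is [{fam x i | i : idx x}] for the small type [idx x]. *)
Definition idx (x : V) : Type := ens_idx (repr x).
Definition fam (x : V) (i : idx x) : V := cls (ens_fam (repr x) i).

Definition mem (x y : V) : Prop := exists i : idx y, x = fam y i.
Notation "x ∈ y" := (mem x y) (at level 70, no associativity).

(** The set [{f a | a : A}]. *)
Definition vset (A : Type) (f : A -> V) : V := cls (sup (fun a => repr (f a))).

Lemma eqv_refl x : eqv x x.
Proof. induction x as [A f IH]; simpl; split; intros a; exists a; auto. Qed.

Lemma eqv_sym x : forall y, eqv x y -> eqv y x.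
Proof.
  induction x as [A f IH]; intros [B g] [H1 H2]; simpl; split.
  - intros b; destruct (H2 b) as [a Ha]; exists a; auto.
  - intros a; destruct (H1 a) as [b Hb]; exists b; auto.
Qed.

Lemma eqv_trans x : forall y z, eqv x y -> eqv y z -> eqv x z.
Proof.
  induction x as [A f IH]; intros [B g] [C h] [H1 H2] [K1 K2]; simpl; split.
  - intros a; destruct (H1 a) as [b Hb]; destruct (K1 b) as [c Hc]; exists c; eauto.
  - intros c; destruct (K2 c) as [b Hb]; destruct (H2 b) as [a Ha]; exists a; eauto.
Qed.

Lemma cls_eq x y : cls x = cls y <-> eqv x y.
Proof.
  split.
  - intros H. assert (E : eqv x = eqv y) by exact (f_equal (@proj1_sig _ _) H).
    rewrite E. apply eqv_refl.
  - intros H. unfold cls. apply subset_eq_compat.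
    apply functional_extensionality; intros z; apply propositional_extensionality.
    split; intros K.
    + eapply eqv_trans; [apply eqv_sym; exact H | exact K].
    + eapply eqv_trans; eauto.
Qed.

Lemma cls_repr X : cls (repr X) = X.
Proof.
  unfold cls, repr. destruct X as [c Hc]. apply subset_eq_compat.
  symmetry. exact (proj2_sig (constructive_indefinite_description _ Hc)).
Qed.

Lemma mem_cls A (f : A -> Ens) x : x ∈ cls (sup f) <-> exists a, x = cls (f a).
Proof.
  assert (E : eqv (repr (cls (sup f))) (sup f)) by (apply cls_eq, cls_repr).
  unfold mem, idx, fam. destruct (repr (cls (sup f))) as [B g]; simpl in *.
  destruct E as [E1 E2]. split; intros [i ->].
  - destruct (E1 i) as [a Ha]; exists a; now apply cls_eq.
  - destruct (E2 i) as [b Hb]; exists b; symmetry; now apply cls_eq.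
Qed.

Lemma mem_vset A (f : A -> V) x : x ∈ vset f <-> exists a, x = f a.
Proof.
  unfold vset. rewrite mem_cls.
  split; intros [a ->]; exists a; [| symmetry]; apply cls_repr.
Qed.

Lemma mem_fam (x : V) (i : idx x) : fam x i ∈ x.
Proof. now exists i. Qed.

Lemma set_ext x y : (forall z, z ∈ x <-> z ∈ y) -> x = y.
Proof.
  intros H. rewrite <- (cls_repr x), <- (cls_repr y) in *.
  destruct (repr x) as [A f], (repr y) as [B g]. apply cls_eq. simpl. split.
  - intros a. destruct (proj1 (mem_cls g (cls (f a)))) as [b Hb].
    + apply H, mem_cls; eauto.
    + exists b; now apply cls_eq.
  - intros b. destruct (proj1 (mem_cls f (cls (g b)))) as [a Ha].
    + apply H, mem_cls; eauto.
    + exists a; apply cls_eq; auto.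
Qed.

Lemma mem_wf : well_founded mem.
Proof.
  assert (H : forall e, Acc mem (cls e)).
  { induction e as [A f IH]. constructor. intros y Hy.
    destruct (proj1 (mem_cls f y) Hy) as [a ->]. apply IH. }
  intros x. rewrite <- (cls_repr x). apply H.
Qed.

(** * Basic set theory *)

Definition elts (x : V) : V -> Prop := fun y => y ∈ x.

Definition subset (x y : V) : Prop := forall z, z ∈ x -> z ∈ y.

(** [{x | P x}]; meaningful only when this class is a set. *)
Definition the_set (P : V -> Prop) : V :=
  epsilon (inhabits (vset (fun e : False => match e with end)))
          (fun y => forall x, x ∈ y <-> P x).

Definition empty : V := vset (fun e : False => match e with end).
Definition upair (x y : V) : V := vset (fun b : bool => if b then x else y).
Definition opair (x y : V) : V := upair (upair x x) (upair x y).
Definition succ (x : V) : V :=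
  vset (fun o : option (idx x) => match o with Some i => fam x i | None => x end).

Fixpoint num (n : nat) : V :=
  match n with 0 => empty | S m => succ (num m) end.
Definition omega : V := vset num.

(** A finite sequence as the function with domain its length. *)
Definition vlist (s : list V) : V :=
  vset (fun i : {i : nat | i < length s} =>
          opair (num (proj1_sig i)) (nth (proj1_sig i) s empty)).

Definition transitive_set (x : V) : Prop := forall y, y ∈ x -> subset y x.

Definition ordinal (a : V) : Prop :=
  transitive_set a /\ forall b, b ∈ a -> transitive_set b.

(** Cardinalities of classes. *)
Definition card_le (A B : V -> Prop) : Prop :=
  exists f : V -> V,
    (forall x, A x -> B (f x)) /\
    (forall x y, A x -> A y -> f x = f y -> x = y).
Definition card_lt (A B : V -> Prop) : Prop := card_le A B /\ ~ card_le B A.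

Definition countable (x : V) : Prop := card_le (elts x) (elts omega).

Definition omega1 : V := the_set (fun a => ordinal a /\ countable a).

Lemma the_setP (P : V -> Prop) : (exists y, forall x, x ∈ y <-> P x) ->
  forall x, x ∈ the_set P <-> P x.
Proof. intros E. exact (epsilon_spec _ _ E). Qed.

Lemma mem_empty x : ~ x ∈ empty.
Proof. unfold empty. rewrite mem_vset. intros [[] _]. Qed.

Lemma mem_upair x y z : z ∈ upair x y <-> z = x \/ z = y.
Proof.
  unfold upair. rewrite mem_vset. split.
  - intros [[|] ->]; auto.
  - intros [->| ->]; [now exists true | now exists false].
Qed.

Lemma opair_inj x y x' y' : opair x y = opair x' y' -> x = x' /\ y = y'.
Proof.
  intros E.
  assert (M : forall z, (z = upair x x \/ z = upair x y) <-> (z = upair x' x' \/ z = upair x' y')).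
  { intros z. rewrite <- !mem_upair. fold (opair x y) (opair x' y'). now rewrite E. }
  assert (U : forall a b c d, upair a b = upair c d ->
                (a = c \/ a = d) /\ (b = c \/ b = d) /\ (c = a \/ c = b) /\ (d = a \/ d = b)).
  { intros a b c d K.
    assert (L : forall z, (z = a \/ z = b) <-> (z = c \/ z = d)).
    { intros z. rewrite <- !mem_upair. now rewrite K. }
    repeat split; apply L; auto. }
  pose proof (proj1 (M _) (or_introl eq_refl)) as A1.
  pose proof (proj1 (M _) (or_intror eq_refl)) as A2.
  pose proof (proj2 (M _) (or_introl eq_refl)) as A3.
  pose proof (proj2 (M _) (or_intror eq_refl)) as A4.
  assert (x = x') by (destruct A1 as [K|K]; apply U in K; intuition congruence).
  subst x'. split; [reflexivity|].
  destruct A2 as [K|K]; apply U in K; destruct A4 as [L|L]; apply U in L; intuition congruence.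
Qed.

Lemma mem_succ x z : z ∈ succ x <-> z ∈ x \/ z = x.
Proof.
  unfold succ. rewrite mem_vset. split.
  - intros [[i|] ->]; [left; apply mem_fam | now right].
  - intros [[i ->]| ->]; [now exists (Some i) | now exists None].
Qed.

Lemma mem_num m n : num m ∈ num n <-> m < n.
Proof.
  assert (A : forall n z, z ∈ num n <-> exists m, m < n /\ z = num m).
  { clear. induction n as [|n IH]; simpl; intros z.
    - split; [intros K; exact (False_ind _ (mem_empty K)) | intros [m [K _]]; lia].
    - rewrite mem_succ, IH. split.
      + intros [[m [K ->]]| ->]; [exists m | exists n]; split; auto; lia.
      + intros [m [K ->]]. destruct (Nat.eq_dec m n) as [->|]; [now right|].
        left; exists m; split; auto; lia. }
  assert (B : forall x, ~ x ∈ x).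
  { intros x. induction (mem_wf x) as [x _ IH]. intros K. exact (IH _ K K). }
  split.
  - intros K. destruct (le_lt_dec n m) as [L|L]; auto. exfalso.
    apply (B (num m)). apply A. apply A in K. destruct K as [k [K E]].
    exists k; split; auto; lia.
  - intros K. apply A; eauto.
Qed.

Lemma num_inj m n : num m = num n -> m = n.
Proof.
  intros E. destruct (Nat.lt_trichotomy m n) as [K|[K|K]]; auto;
    apply mem_num in K; rewrite E in K; apply mem_num in K; lia.
Qed.

Lemma omega1P a : a ∈ omega1 <-> ordinal a /\ countable a.
Proof.
  apply the_setP. clear a.
  (* A nonempty countable ordinal is determined by the relation induced on
     [nat] by an enumeration of it. *)
  pose (coded := fun (R : nat -> nat -> Prop) a => ordinal a /\ countable a /\
          exists e : nat -> V, (forall x, x ∈ a <-> exists n, x = e n) /\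
            forall m n, R m n <-> e m ∈ e n).
  assert (Cu : forall R a b, coded R a -> coded R b -> a = b).
  { intros R a b [Oa [_ [e [Ea Ra]]]] [Ob [_ [g [Eb Rb]]]].
    assert (K : forall x n, x = e n -> e n = g n).
    { intros x. induction (mem_wf x) as [x _ IH]. intros n ->.
      apply set_ext; intros z; split; intros Hz.
      - assert (M : z ∈ a) by (apply (proj1 Oa (e n)); [apply Ea; eauto | exact Hz]).
        apply Ea in M. destruct M as [m ->].
        rewrite (IH _ Hz m eq_refl). apply Rb, Ra, Hz.
      - assert (M : z ∈ b) by (apply (proj1 Ob (g n)); [apply Eb; eauto | exact Hz]).
        apply Eb in M. destruct M as [m ->].
        assert (L : e m ∈ e n) by (apply Ra, Rb, Hz).
        rewrite <- (IH _ L m eq_refl). exact L. }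
    apply set_ext; intros z. rewrite Ea, Eb.
    split; intros [n ->]; exists n; [|symmetry]; eapply K; eauto. }
  exists (vset (fun o : option {R | exists a, coded R a} =>
            match o with
            | None => empty
            | Some R => proj1_sig (constructive_indefinite_description _ (proj2_sig R))
            end)).
  intros a. rewrite mem_vset. split.
  - intros [[[R HR]|] ->]; simpl.
    + destruct (constructive_indefinite_description _ HR) as [b HB]; simpl. unfold coded in HB; tauto.
    + split; [split; intros y K; exfalso; exact (mem_empty K)|].
      exists (fun x => x). split; intros x; [intros K | intros y K];
        exfalso; exact (mem_empty K).
  - intros [Oa Ca].
    destruct (classic (exists x0, x0 ∈ a)) as [[x0 Hx0]|Ne].
    + assert (Ca' := Ca). destruct Ca' as [f [F1 F2]].
      pose (e := fun n => epsilon (inhabits x0) (fun x => x ∈ a /\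
                   ((f x = num n) \/ (x = x0 /\ forall y, y ∈ a -> f y <> num n)))).
      assert (He : forall n, e n ∈ a /\
                (f (e n) = num n \/ (e n = x0 /\ forall y, y ∈ a -> f y <> num n))).
      { intros n. apply (epsilon_spec (inhabits x0) (fun x => x ∈ a /\
           ((f x = num n) \/ (x = x0 /\ forall y, y ∈ a -> f y <> num n)))).
        destruct (classic (exists y, y ∈ a /\ f y = num n)) as [[y [Y1 Y2]]|Q].
        - exists y; auto.
        - exists x0; split; auto. right; split; auto. intros y Y1 Y2; apply Q; eauto. }
      assert (C : coded (fun m n => e m ∈ e n) a).
      { split; [exact Oa|]. split; [exact Ca|]. exists e. split; [|tauto].
        intros x; split.
        - intros Hx. pose proof (F1 x Hx) as W. unfold elts, omega in W.
          destruct (proj1 (mem_vset _ _) W) as [n Hn]. exists n.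
          destruct (He n) as [N1 [N2|[_ N2]]].
          + apply F2; auto. congruence.
          + destruct (N2 x Hx Hn).
        - intros [n ->]. apply He. }
      exists (Some (exist (fun R => exists a, coded R a) _ (ex_intro _ a C))). simpl.
      destruct (constructive_indefinite_description _ _) as [b B]; simpl.
      exact (Cu _ _ _ C B).
    + exists None. apply set_ext; intros z; split; intros K.
      * destruct Ne; eauto.
      * exact (False_ind _ (mem_empty K)).
Qed.

Definition cardinal (k : V) : Prop :=
  ordinal k /\ forall a, a ∈ k -> card_lt (elts a) (elts k).

Definition regular (k : V) : Prop :=
  cardinal k /\ subset omega k /\
  forall a, a ∈ k -> forall f : V -> V,
    (forall i, i ∈ a -> f i ∈ k) ->
    exists b, b ∈ k /\ forall i, i ∈ a -> f i ∈ b.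

(** [Hered k], usually written H(k): the sets whose transitive closure has fewer than [k] elements. *)
Definition Hered (k : V) : V -> Prop :=
  fun x => card_lt (fun y => clos_trans V mem y x) (elts k).

Definition well_orders (A : V -> Prop) (R : V -> V -> Prop) : Prop :=
  (forall x, A x -> ~ R x x) /\
  (forall x y z, A x -> A y -> A z -> R x y -> R y z -> R x z) /\
  (forall x y, A x -> A y -> R x y \/ x = y \/ R y x) /\
  (forall B : V -> Prop, (forall x, B x -> A x) -> (exists x, B x) ->
     exists m, B m /\ forall y, B y -> y = m \/ R m y).

(** ** Stationary subsets of [omega1] *)

Definition club (C : V) : Prop :=
  subset C omega1 /\
  (forall a, a ∈ omega1 -> exists b, b ∈ C /\ a ∈ b) /\
  (forall d, d ∈ omega1 -> d <> empty ->
     (forall a, a ∈ d -> exists b, b ∈ C /\ b ∈ d /\ a ∈ b) -> d ∈ C).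

Definition stationary (S : V) : Prop :=
  subset S omega1 /\ forall C, club C -> exists a, a ∈ S /\ a ∈ C.

(** ** Elementary submodels *)

(** Formulas in the language of a membership and an order, with de Bruijn
    indices. *)
Inductive fml : Type :=
| FEq (i j : nat)
| FMem (i j : nat)
| FLt (i j : nat)
| FNot (f : fml)
| FAnd (f g : fml)
| FAll (f : fml).

Definition scons (x : V) (e : nat -> V) : nat -> V :=
  fun i => match i with 0 => x | S j => e j end.

Fixpoint sat (A : V -> Prop) (R : V -> V -> Prop) (f : fml) (e : nat -> V) : Prop :=
  match f with
  | FEq i j => e i = e j
  | FMem i j => e i ∈ e j
  | FLt i j => R (e i) (e j)
  | FNot f => ~ sat A R f e
  | FAnd f g => sat A R f e /\ sat A R g e
  | FAll f => forall x, A x -> sat A R f (scons x e)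
  end.

(** [W k] is the fixed well-order of [Hered k]. *)
Definition wo_system (W : V -> V -> V -> Prop) : Prop :=
  forall k, regular k -> well_orders (Hered k) (W k).

Definition elem_sub (W : V -> V -> V -> Prop) (k N : V) : Prop :=
  N <> empty /\
  (forall x, x ∈ N -> Hered k x) /\
  (forall f e, (forall i, e i ∈ N) -> (sat (elts N) (W k) f e <-> sat (Hered k) (W k) f e)).

Definition eventually (Phi : V -> Prop) : Prop :=
  exists k0, ordinal k0 /\ forall k, regular k -> k0 ∈ k -> Phi k.

(** [d] is [N ∩ omega1]. *)
Definition trace_omega1 (N d : V) : Prop :=
  forall x, x ∈ d <-> x ∈ N /\ x ∈ omega1.

(** * Forcing *)

(** [opair p q ∈ f_le] means [p <= q], that is, [q] is stronger. *)
Record forcing : Type := {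
  f_car : V;
  f_le : V;
  f_le_sub : forall z, z ∈ f_le -> exists p q, p ∈ f_car /\ q ∈ f_car /\ z = opair p q;
  f_nonempty : exists p, p ∈ f_car;
  f_refl : forall p, p ∈ f_car -> opair p p ∈ f_le;
  f_trans : forall p q r, opair p q ∈ f_le -> opair q r ∈ f_le -> opair p r ∈ f_le
}.

Definition f_code (P : forcing) : V := opair (f_car P) (f_le P).

Definition cond (P : forcing) (p : V) : Prop := p ∈ f_car P.
Definition ple (P : forcing) (p q : V) : Prop := opair p q ∈ f_le P.

Definition f_dense (P : forcing) (D : V) : Prop :=
  subset D (f_car P) /\ forall p, cond P p -> exists q, q ∈ D /\ ple P p q.

(** ** Names *)

Inductive is_name (P : forcing) : V -> Prop :=
| Is_name : forall tau,
    (forall z, z ∈ tau -> exists sigma p, z = opair sigma p /\ cond P p) ->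
    (forall sigma p, opair sigma p ∈ tau -> is_name P sigma) ->
    is_name P tau.

(** The check name [{(check y, p) | y ∈ x, p ∈ P}] of [x]; no weakest condition
    is assumed to exist. *)
Fixpoint ens_check (P : forcing) (x : Ens) : V :=
  match x with
  | sup f => vset (fun ai : _ * idx (f_car P) =>
                     opair (ens_check P (f (fst ai))) (fam (f_car P) (snd ai)))
  end.

Definition check (P : forcing) (x : V) : V := ens_check P (repr x).

Lemma mem_check P x z : z ∈ check P x <->
  exists y p, y ∈ x /\ cond P p /\ z = opair (check P y) p.
Proof.
  assert (E : forall a b, eqv a b -> ens_check P a = ens_check P b).
  { induction a as [A f IH]; intros [B g] [E1 E2]; simpl.
    apply set_ext; intros w; rewrite !mem_vset; split; intros [[i j] ->]; simpl.
    - destruct (E1 i) as [b Hb]. exists (b, j); simpl. now rewrite (IH i _ Hb).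
    - destruct (E2 i) as [a Ha]. exists (a, j); simpl. now rewrite (IH a _ Ha). }
  assert (K : forall a, check P (cls a) = ens_check P a).
  { intros a. apply E, cls_eq, cls_repr. }
  assert (M : forall e, z ∈ ens_check P e <->
                exists y p, y ∈ cls e /\ cond P p /\ z = opair (check P y) p).
  { intros [A f]; simpl. rewrite mem_vset. split.
    - intros [[a j] ->]; simpl. exists (cls (f a)), (fam (f_car P) j).
      rewrite K. repeat split; [apply mem_cls; eauto | apply mem_fam].
    - intros [y [p [Hy [[j ->] ->]]]]. destruct (proj1 (mem_cls _ _) Hy) as [a ->].
      exists (a, j); simpl. now rewrite K. }
  pose proof (M (repr x)) as R. rewrite cls_repr in R. exact R.
Qed.

Definition Gdot (P : forcing) : V :=
  vset (fun i : idx (f_car P) => opair (check P (fam (f_car P) i)) (fam (f_car P) i)).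

(** The name of [N[G]], the set of interpretations of the names lying in [N]. *)
Definition NGdot (P : forcing) (N : V) : V :=
  vset (fun ti : {i : idx N | is_name P (fam N i)} * idx (f_car P) =>
          opair (fam N (proj1_sig (fst ti))) (fam (f_car P) (snd ti))).

(** ** The forcing relation

    A statement of the forcing language is represented by the class of
    conditions forcing it. *)

Definition statement : Type := V -> Prop.

(** The usual recursion for equality of names: every element of one name is,
    densely above [p], forced to equal an element of the other. It is given as
    an inductive relation, the recursion on names being well-founded. *)
Inductive forces_eq (P : forcing) : V -> V -> V -> Prop :=
| Forces_eq : forall p t1 t2,
    (forall s1 r1, opair s1 r1 ∈ t1 -> forall q, ple P p q ->
       exists r, ple P q r /\
         (ple P r1 r -> exists s2 r2, opair s2 r2 ∈ t2 /\ ple P r2 r /\ forces_eq P r s1 s2)) ->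
    (forall s2 r2, opair s2 r2 ∈ t2 -> forall q, ple P p q ->
       exists r, ple P q r /\
         (ple P r2 r -> exists s1 r1, opair s1 r1 ∈ t1 /\ ple P r1 r /\ forces_eq P r s1 s2)) ->
    forces_eq P p t1 t2.

Definition f_mem (P : forcing) (s t : V) : statement :=
  fun p => forall q, ple P p q ->
    exists r, ple P q r /\
      exists s' r', opair s' r' ∈ t /\ ple P r' r /\ forces_eq P r s s'.

Definition f_not (P : forcing) (A : statement) : statement :=
  fun p => forall q, ple P p q -> ~ A q.

Definition f_and (A B : statement) : statement := fun p => A p /\ B p.

Definition f_imp (P : forcing) (A B : statement) : statement :=
  f_not P (f_and A (f_not P B)).

(** Quantifiers over those [i : I] that satisfy [B]. For [I := V] and
    [B := is_name P] these range over the generic extension; for other [B],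
    over objects of the ground model. *)
Definition f_all (I : Type) (B : I -> Prop) (A : I -> statement) : statement :=
  fun p => forall i, B i -> A i p.

Definition f_ex (P : forcing) (I : Type) (B : I -> Prop) (A : I -> statement) : statement :=
  fun p => forall q, ple P p q -> exists r, ple P q r /\ exists i, B i /\ A i r.

(** [q] is [(N, P)]-generic. *)
Definition generic_cond (N : V) (P : forcing) (q : V) : Prop :=
  forall D, f_dense P D -> D ∈ N ->
    f_ex P (fun d => d ∈ D /\ d ∈ N) (fun d => f_mem P (check P d) (Gdot P)) q.

(** * The game *)

(** A move is a finite sequence of conditions; COM and INC alternate, COM
    starting. [com n] and [inc n] are the moves of round [n]. *)
Definition move := list V.

Fixpoint position (com inc : nat -> move) (k : nat) : list move :=
  match k with
  | 0 => []
  | S k' => position com inc k' ++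
            [if Nat.even k' then com (Nat.div2 k') else inc (Nat.div2 k')]
  end.

Definition position_in (N : V) (s : list move) : Prop := vlist (map vlist s) ∈ N.

Definition com_legal (N : V) (P : forcing) (com inc : nat -> move) (n : nat) : Prop :=
  com n <> [] /\ Forall (cond P) (com n) /\
  position_in N (position com inc (2 * n + 1)).

Definition inc_legal (N : V) (P : forcing) (com inc : nat -> move) (n : nat) : Prop :=
  Forall (cond P) (inc n) /\ Forall2 (ple P) (com n) (inc n) /\
  position_in N (position com inc (2 * n + 2)).

Definition com_wins (P : forcing) (p : V) (inc : nat -> move) : Prop :=
  forall u : nat -> Prop, (forall m, exists n, m <= n /\ u n) ->
    exists q, cond P q /\ ple P p q /\
      f_all (fun _ : nat => True) (fun m =>
        f_ex P (fun n => m <= n /\ u n) (fun n =>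
          f_ex P (fun l => l < length (inc n)) (fun l =>
            f_mem P (check P (nth l (inc n) empty)) (Gdot P)))) q.

Definition com_winning_strategy (N : V) (P : forcing) (p : V)
    (st : list move -> move) : Prop :=
  forall com inc : nat -> move,
    (forall n, com n = st (position com inc (2 * n))) ->
    (forall n, (forall m, m < n -> inc_legal N P com inc m) -> com_legal N P com inc n) /\
    ((forall n, inc_legal N P com inc n) -> com_wins P p inc).

Definition Pr2 (W : V -> V -> V -> Prop) (S : V) (P : forcing) : Prop :=
  eventually (fun k =>
    forall N, elem_sub W k N -> countable N -> f_code P ∈ N ->
    forall d, trace_omega1 N d -> d ∈ S ->
    forall p, cond P p -> p ∈ N ->
    exists st, com_winning_strategy N P p st).

(** * Trees *)

Record tree : Type := {
  t_car : V;
  t_lt : V;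
  t_lt_sub : forall z, z ∈ t_lt -> exists s t, s ∈ t_car /\ t ∈ t_car /\ z = opair s t;
  t_irrefl : forall t, ~ opair t t ∈ t_lt;
  t_trans : forall r s t, opair r s ∈ t_lt -> opair s t ∈ t_lt -> opair r t ∈ t_lt;
  t_pred_wo : forall t, t ∈ t_car ->
    well_orders (fun s => opair s t ∈ t_lt) (fun r s => opair r s ∈ t_lt)
}.

Definition t_code (T : tree) : V := opair (t_car T) (t_lt T).

Definition tlt (T : tree) (s t : V) : Prop := opair s t ∈ t_lt T.
Definition tle (T : tree) (s t : V) : Prop := s = t \/ tlt T s t.

(** [t] is on level [a]: the order type of its predecessors is [a]. *)
Definition on_level (T : tree) (a t : V) : Prop :=
  t ∈ t_car T /\ ordinal a /\
  exists f : V -> V,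
    (forall i, i ∈ a -> tlt T (f i) t) /\
    (forall s, tlt T s t -> exists i, i ∈ a /\ s = f i) /\
    (forall i j, i ∈ a -> j ∈ a -> (i ∈ j <-> tlt T (f i) (f j))).

Definition has_height (T : tree) (h : V) : Prop :=
  ordinal h /\ forall a, ordinal a -> ((exists t, on_level T a t) <-> a ∈ h).

Definition normal_tree (T : tree) : Prop :=
  forall a b t, on_level T a t -> a ∈ b -> b ∈ omega1 ->
    exists s s', s <> s' /\ on_level T b s /\ on_level T b s' /\ tlt T t s /\ tlt T t s'.

Definition omega1_tree (T : tree) : Prop :=
  card_le (elts (t_car T)) (elts omega1) /\
  card_le (elts omega1) (elts (t_car T)) /\
  has_height T omega1 /\
  (forall a, a ∈ omega1 -> card_le (on_level T a) (elts omega)) /\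
  normal_tree T.

Definition t_dense (T : tree) (D : V) : Prop :=
  subset D (t_car T) /\ forall s, s ∈ t_car T -> exists s', s' ∈ D /\ tle T s s'.

(** [{s | s < t}] is [(N, T)]-generic. *)
Definition generic_branch (N : V) (T : tree) (t : V) : Prop :=
  forall D, D ∈ N -> t_dense T D -> exists s, tlt T s t /\ s ∈ D.

(** ** The same notions in the forcing language *)

Definition forced_t_dense (P : forcing) (T : tree) (D : V) : statement :=
  f_and
    (f_all (is_name P) (fun x => f_imp P (f_mem P x D) (f_mem P x (check P (t_car T)))))
    (f_all (elts (t_car T)) (fun s =>
       f_ex P (fun s' => s' ∈ t_car T /\ tle T s s') (fun s' => f_mem P (check P s') D))).

Definition forced_generic_branch (N : V) (P : forcing) (T : tree) (t : V) : statement :=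
  f_all (is_name P) (fun D =>
    f_imp P (f_and (f_mem P D (NGdot P N)) (forced_t_dense P T D))
      (f_ex P (fun s => tlt T s t) (fun s => f_mem P (check P s) D))).

Definition preserving (W : V -> V -> V -> Prop) (T : tree) (Y S : V) (P : forcing) : Prop :=
  eventually (fun k =>
    exists x, Hered k x /\
    forall N, elem_sub W k N -> countable N ->
      x ∈ N -> Y ∈ N -> t_code T ∈ N -> f_code P ∈ N -> S ∈ N ->
    forall p, cond P p -> p ∈ N ->
    forall d, trace_omega1 N d -> d ∈ S ->
      (forall t, t ∈ Y -> on_level T d t -> generic_branch N T t) ->
      exists q, cond P q /\ ple P p q /\ generic_cond N P q /\
        f_all (fun t => t ∈ Y /\ on_level T d t)
              (fun t => forced_generic_branch N P T t) q).

(* Main.v *)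
(** INC plays so that the answers of round [n] meet the first [n] of countably many
    tasks. One kind of task is to lie above an element of a dense subset of [P] in
    [N]. The other is given by a name [D] in [N] and a node [t] of [Y] on level
    [N ∩ omega1], and asks to decide that [D] is not dense in [T], or to force some
    [s < t] into [D]. It can be met below every [p] in [N]: the set [E] of the nodes
    that some extension of [p] forces into [D] belongs to [N]; if it is dense, then
    the branch below [t] meets it, and otherwise [p] forces that [D] is not dense. A
    condition forcing that infinitely many rounds have an answer in the generic filter
    then has both genericity properties.

    That [E] belongs to [N] holds because the forcing of equality between names in a
    set [M] closed under subnames is definable over [H(k)] as the only relation on [M]
    that satisfies the recursive clause. The parameter [x] of preservation codes the
    check names of the nodes and enumerations of the levels of [T]; through the latter
    all predecessors of [t] belong to [N]. *)

From Stdlib Require Import List Arith Cantor Lia Relations Wellfounded Classical ClassicalEpsilon.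
Require Import Defs.
Import ListNotations.

(** * Ordinals, countable enumerations and transitive closures *)

Lemma mem_irrefl x : ~ x ∈ x.
Proof. induction (mem_wf x) as [x _ IH]. intros K. exact (IH _ K K). Qed.

Lemma ordinal_mem a b : ordinal a -> b ∈ a -> ordinal b.
Proof.
  intros [A1 A2] B. split; [auto|]. intros c C. exact (A2 c (A1 b B c C)).
Qed.

(** By a double induction on membership: if neither ordinal belongs to the other, comparing the
    elements of each with the other ordinal shows that both have the same elements. *)
Lemma ordinal_trichotomy a b : ordinal a -> ordinal b -> a ∈ b \/ a = b \/ b ∈ a.
Proof.
  revert b. induction (mem_wf a) as [a _ IHa]. intros b Oa.
  induction (mem_wf b) as [b _ IHb]. intros Ob.
  destruct (classic (a ∈ b)) as [|Nab]; [auto|].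
  destruct (classic (b ∈ a)) as [|Nba]; [auto|].
  right; left. apply set_ext; intros z; split; intros Hz.
  - destruct (IHa z Hz b (ordinal_mem _ _ Oa Hz) Ob) as [K|[->|K]]; [auto|tauto|].
    destruct Nba. exact (proj1 Oa z Hz b K).
  - destruct (IHb z Hz (ordinal_mem _ _ Ob Hz)) as [K|[->|K]]; [|tauto|auto].
    destruct Nab. exact (proj1 Ob z Hz a K).
Qed.

Lemma card_le_omega_enum (A : V -> Prop) : card_le A (elts omega) ->
  exists e : nat -> V, forall a, A a -> exists n, e n = a.
Proof.
  intros [f [F1 F2]].
  exists (fun n => epsilon (inhabits empty) (fun a => A a /\ f a = num n)).
  intros a Ha. destruct (proj1 (mem_vset _ _) (F1 a Ha)) as [n Hn]. exists n.
  destruct (epsilon_spec (inhabits empty) (fun a => A a /\ f a = num n)) as [E1 E2]; [eauto|].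
  apply F2; congruence.
Qed.

Lemma clos_trans_mem y x :
  clos_trans V mem y x <-> y ∈ x \/ exists z, z ∈ x /\ clos_trans V mem y z.
Proof.
  split.
  - intros K. apply clos_trans_tn1 in K. destruct K as [|z x K1 K2]; [auto|].
    right; exists z; split; [auto|]. now apply clos_tn1_trans.
  - intros [K|[z [K1 K2]]]; [now apply t_step|]. eapply Relation_Operators.t_trans; [eauto|now apply t_step].
Qed.

(** * Hereditarily small sets *)

Section Hereditary.

Variable k : V.
Hypothesis Hk : regular k.

(** This is the negative half of [card_lt A (elts k)]. It passes to subclasses by mere composition,
    and [small_card_lt] shows that for regular [k] it gives the other half. *)
Definition small (A : V -> Prop) : Prop := ~ card_le (elts k) A.

(** Transfinite recursion picks [g i] in [A] outside the values at elements of [i]. If no stage in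
    [k] exhausted [A], then [g] would inject [k] into [A]. *)
Lemma small_enum A : small A ->
  exists a g, a ∈ k /\ forall x, A x -> exists i, i ∈ a /\ x = g i.
Proof.
  intros SA.
  pose (F := fun (i : V) (g : forall j, j ∈ i -> V) =>
    epsilon (inhabits empty) (fun x => A x /\ forall j (Hj : j ∈ i), g j Hj <> x)).
  pose (g := Fix mem_wf (fun _ => V) F).
  assert (G : forall i, g i = epsilon (inhabits empty)
                (fun x => A x /\ forall j, j ∈ i -> g j <> x)).
  { intros i. unfold g at 1. rewrite Fix_eq; [reflexivity|].
    intros x f h E. unfold F. f_equal.
    apply FunctionalExtensionality.functional_extensionality; intros y.
    apply PropExtensionality.propositional_extensionality.
    split; intros [K1 K2]; (split; [auto|]); intros j Hj; [rewrite <- E | rewrite E]; auto. }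
  apply NNPP; intros Ne. apply SA. exists g.
  assert (K : forall i, i ∈ k -> A (g i) /\ forall j, j ∈ i -> g j <> g i).
  { intros i Hi. rewrite G.
    apply (epsilon_spec (inhabits empty) (fun x => A x /\ forall j, j ∈ i -> g j <> x)).
    apply NNPP; intros N. apply Ne. exists i, g; split; [auto|]. intros x Ax.
    apply NNPP; intros N'. apply N. exists x; split; [auto|]. intros j Hj E. eauto. }
  split; [intros i Hi; now apply K|]. intros i j Hi Hj E.
  pose proof (proj1 (proj1 Hk)) as Ok.
  destruct (ordinal_trichotomy i j) as [L|[L|L]]; try (eapply ordinal_mem; eauto; fail); auto.
  - now destruct (proj2 (K j Hj) i L).
  - now destruct (proj2 (K i Hi) j L).
Qed.

(** Choosing an index for each element in the enumeration of [small_enum] injects [A] into some [a]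
    in [k], hence into [k]. *)
Lemma small_card_lt A : small A <-> card_lt A (elts k).
Proof.
  split; [|intros [_ K]; exact K].
  intros SA. split; [|exact SA].
  destruct (small_enum A SA) as [a [g [Ha G]]].
  pose (h := fun x => epsilon (inhabits empty) (fun i => i ∈ a /\ x = g i)).
  assert (E : forall x, A x -> h x ∈ a /\ x = g (h x)).
  { intros x Ax. apply (epsilon_spec (inhabits empty) (fun i => i ∈ a /\ x = g i)); auto. }
  exists h. split.
  - intros x Ax. apply (proj1 (proj1 (proj1 Hk)) a Ha). now apply E.
  - intros x y Ax Ay K. rewrite (proj2 (E x Ax)), (proj2 (E y Ay)). congruence.
Qed.

Lemma small_sub (A B : V -> Prop) : (forall x, A x -> B x) -> small B -> small A.
Proof. intros I SB [f [F1 F2]]. apply SB. exists f; split; auto. Qed.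

Lemma small_mem a : a ∈ k -> small (elts a).
Proof. intros Ha. apply small_card_lt. exact (proj2 (proj1 Hk) a Ha). Qed.

Lemma num_mem_regular n : num n ∈ k.
Proof. apply (proj1 (proj2 Hk)). apply mem_vset; eauto. Qed.

Lemma small_bounded (A : V -> Prop) : small A -> (forall x, A x -> x ∈ k) ->
  exists b, b ∈ k /\ forall x, A x -> x ∈ b.
Proof.
  intros SA I. destruct (small_enum A SA) as [a [g [Ha G]]].
  (* Regularity asks for values in [k] on all of [a], so values of the enumeration outside [k] are
     replaced by 0. *)
  pose (h := fun i => if excluded_middle_informative (g i ∈ k) then g i else num 0).
  destruct (proj2 (proj2 Hk) a Ha h) as [b [Hb B]].
  - intros i _. unfold h. destruct excluded_middle_informative; [auto|apply num_mem_regular].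
  - exists b; split; [auto|]. intros x Ax. destruct (G x Ax) as [i [Hi ->]].
    pose proof (B i Hi) as K. unfold h in K.
    destruct excluded_middle_informative as [|N]; [auto|]. destruct N; auto.
Qed.

(* If [k] injected into the union, regularity would bound each of the fewer
   than [k] preimages, and then [k] itself, below [k]. *)
Lemma small_union (A : V -> Prop) (B : V -> V -> Prop) :
  small A -> (forall x, A x -> small (B x)) -> small (fun y => exists x, A x /\ B x y).
Proof.
  intros SA SB [f [F1 F2]].
  destruct (small_enum A SA) as [a [g [Ha G]]].
  assert (Bd : forall x, A x -> exists b, b ∈ k /\ forall z, z ∈ k -> B x (f z) -> z ∈ b).
  { intros x Ax. destruct (small_bounded (fun z => z ∈ k /\ B x (f z))) as [b [Hb K]].
    - intros [h [h1 h2]]. apply (SB x Ax). exists (fun z => f (h z)). split.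
      + intros z Hz. now apply h1.
      + intros y z Hy Hz E. apply h2; auto. apply F2; auto; now apply h1.
    - tauto.
    - exists b; auto. }
  pose (h := fun i => epsilon (inhabits (num 0)) (fun b => b ∈ k /\
               (A (g i) -> forall z, z ∈ k -> B (g i) (f z) -> z ∈ b))).
  assert (E : forall i, h i ∈ k /\ (A (g i) -> forall z, z ∈ k -> B (g i) (f z) -> z ∈ h i)).
  { intros i. apply (epsilon_spec (inhabits (num 0)) (fun b => b ∈ k /\
               (A (g i) -> forall z, z ∈ k -> B (g i) (f z) -> z ∈ b))).
    destruct (classic (A (g i))) as [K|K].
    - destruct (Bd _ K) as [b [B1 B2]]. eauto.
    - exists (num 0). split; [apply num_mem_regular|tauto]. }
  destruct (proj2 (proj2 Hk) a Ha h) as [b [Hb K]]; [intros; apply E|].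
  (* The value [f b] lies in some [B (g i)], so [b] is below [h i], which is below [b]. *)
  apply (mem_irrefl b). destruct (F1 b Hb) as [x [Ax Bx]].
  destruct (G x Ax) as [i [Hi ->]].
  apply (proj1 (ordinal_mem _ _ (proj1 (proj1 Hk)) Hb) (h i) (K i Hi)).
  now apply E.
Qed.

Lemma small_image (A : V -> Prop) (f : V -> V) :
  small A -> small (fun y => exists x, A x /\ y = f x).
Proof.
  intros SA. apply (small_union A (fun x y => y = f x)); auto. intros x _ [h [h1 h2]].
  (* A singleton is small, since an injection of [k] into it would identify 0 and 1. *)
  assert (K : num 0 = num 1).
  { apply h2; try apply num_mem_regular.
    now rewrite (h1 (num 0)), (h1 (num 1)); try apply num_mem_regular. }
  apply num_inj in K. discriminate.
Qed.

Lemma small_image2 (A B : V -> Prop) (f : V -> V -> V) : small A -> small B ->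
  small (fun z => exists x, A x /\ exists y, B y /\ z = f x y).
Proof. intros SA SB. apply small_union; auto. intros x _. now apply small_image. Qed.

Lemma small_or (A B : V -> Prop) : small A -> small B -> small (fun x => A x \/ B x).
Proof.
  intros SA SB.
  (* The union is indexed by the two elements of 2, so that [small_union] applies. *)
  apply (small_sub _ (fun x => exists n, elts (num 2) n /\
           ((n = num 0 /\ A x) \/ (n <> num 0 /\ B x)))).
  - intros x [K|K]; [exists (num 0)|exists (num 1)].
    + split; [apply mem_num; lia|auto].
    + split; [apply mem_num; lia|]. right; split; [|auto]. intros E.
      apply num_inj in E; discriminate.
  - apply small_union; [apply small_mem, num_mem_regular|]. intros n _.
    destruct (classic (n = num 0)) as [->|Ne].
    + apply (small_sub _ A); [tauto|auto].
    + apply (small_sub _ B); [tauto|auto].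
Qed.

Lemma small_eq a : small (fun x => x = a).
Proof.
  apply (small_sub _ (fun y => exists x, elts (num 1) x /\ y = (fun _ => a) x)).
  - intros x ->. exists (num 0); split; [apply mem_num; lia|auto].
  - apply small_image, small_mem, num_mem_regular.
Qed.

(** The enumeration presents [A] as a family over a subtype of [idx a], and [vset] turns such a
    family into a set. *)
Lemma small_set A : small A -> exists x, forall y, y ∈ x <-> A y.
Proof.
  intros SA. destruct (small_enum A SA) as [a [g [_ G]]].
  exists (vset (fun i : {i : idx a | A (g (fam a i))} => g (fam a (proj1_sig i)))).
  intros y. rewrite mem_vset. split.
  - intros [[i Hi] ->]. exact Hi.
  - intros Ay. destruct (G y Ay) as [j [[i ->] ->]]. now exists (exist _ i Ay).
Qed.

(** * Closure properties of H(k) *)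

Lemma Hered_small x : Hered k x -> small (elts x).
Proof.
  intros K. apply small_card_lt in K. revert K. apply small_sub.
  intros y Hy. now apply t_step.
Qed.

Lemma Hered_clos_trans x y : Hered k x -> clos_trans V mem y x -> Hered k y.
Proof.
  unfold Hered. rewrite <- !small_card_lt. intros K Hy. revert K. apply small_sub.
  intros z Hz. eapply Relation_Operators.t_trans; eauto.
Qed.

Lemma Hered_mem x y : Hered k x -> y ∈ x -> Hered k y.
Proof. intros K Hy. eapply Hered_clos_trans; [eauto|]. now apply t_step. Qed.

(** The transitive closure of [x] consists of [x] and the closures of its elements, which is a small
    union of small classes. *)
Lemma Hered_intro x : small (elts x) -> (forall y, y ∈ x -> Hered k y) -> Hered k x.
Proof.
  intros Sx K. apply small_card_lt.
  apply (small_sub _ (fun y => y ∈ x \/ exists z, z ∈ x /\ clos_trans V mem y z)).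
  - intros y. apply clos_trans_mem.
  - apply small_or; [auto|]. apply small_union; [auto|].
    intros z Hz. apply small_card_lt. now apply K.
Qed.

(** Separation and replacement in H(k). It supplies the witnesses that elementarity later reflects
    into [N]. *)
Lemma Hered_class (A : V -> Prop) : small A -> (forall y, A y -> Hered k y) ->
  exists x, Hered k x /\ forall y, y ∈ x <-> A y.
Proof.
  intros SA K. destruct (small_set A SA) as [x Hx]. exists x; split; [|auto].
  apply Hered_intro.
  - revert SA. apply small_sub. apply Hx.
  - intros y Hy. now apply K, Hx.
Qed.

Lemma Hered_empty : Hered k empty.
Proof.
  apply Hered_intro; [|intros y Hy; now apply mem_empty in Hy].
  apply (small_mem empty), (num_mem_regular 0).
Qed.

Lemma Hered_upair x y : Hered k x -> Hered k y -> Hered k (upair x y).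
Proof.
  intros Hx Hy. apply Hered_intro.
  - apply (small_sub _ (fun z => z = x \/ z = y)).
    + intros z. apply mem_upair.
    + apply small_or; apply small_eq.
  - intros z Hz. apply mem_upair in Hz. destruct Hz as [-> | ->]; auto.
Qed.

Lemma Hered_opair x y : Hered k x -> Hered k y -> Hered k (opair x y).
Proof. intros; repeat apply Hered_upair; auto. Qed.

Lemma Hered_opair_inv x y : Hered k (opair x y) -> Hered k x /\ Hered k y.
Proof.
  intros K. assert (L : Hered k (upair x y)).
  { apply (Hered_mem _ _ K). apply mem_upair; auto. }
  split; apply (Hered_mem _ _ L); apply mem_upair; auto.
Qed.

Lemma Hered_pair_mem x y z : Hered k z -> opair x y ∈ z -> Hered k x /\ Hered k y.
Proof. intros Hz K. apply Hered_opair_inv. now apply (Hered_mem z). Qed.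

Lemma Hered_num n : Hered k (num n).
Proof.
  induction n as [|n IH]; [exact Hered_empty|]. simpl. apply Hered_intro.
  - apply (small_mem (num (S n))), num_mem_regular.
  - intros y Hy. apply mem_succ in Hy. destruct Hy as [Hy| ->]; [|auto].
    now apply (Hered_mem (num n)).
Qed.

Lemma Hered_check P x : Hered k (f_car P) -> Hered k x -> Hered k (check P x).
Proof.
  intros HP. induction (mem_wf x) as [x _ IH]. intros Hx. apply Hered_intro.
  - apply (small_sub _ (fun z => exists y, elts x y /\ exists p, elts (f_car P) p /\
                                   z = opair (check P y) p)).
    + intros z Hz. apply mem_check in Hz. destruct Hz as [y [p [? [? ?]]]].
      exists y; split; [auto|]. exists p; auto.
    + apply (small_image2 _ _ (fun y p => opair (check P y) p)); now apply Hered_small.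
  - intros z Hz. apply mem_check in Hz. destruct Hz as [y [p [Hy [Hp ->]]]].
    apply Hered_opair; [apply IH; [auto|]|]; (eapply Hered_mem; [|eassumption]; assumption).
Qed.

End Hereditary.

(** * Forcing *)

Section Forcing.

Variable P : forcing.

Lemma ple_cond p q : ple P p q -> cond P p /\ cond P q.
Proof.
  intros K. destruct (f_le_sub P K) as [p' [q' [H1 [H2 E]]]].
  apply opair_inj in E. destruct E as [-> ->]. auto.
Qed.

Lemma ple_refl p : cond P p -> ple P p p.
Proof. apply f_refl. Qed.

Lemma ple_trans p q r : ple P p q -> ple P q r -> ple P p r.
Proof. apply f_trans. Qed.

Lemma opair_clos_trans s r t :
  opair s r ∈ t -> clos_trans V mem s t /\ clos_trans V mem r t.
Proof.
  intros K.
  split; (eapply Relation_Operators.t_trans; [|apply t_step; exact K]);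
    (eapply Relation_Operators.t_trans; [|apply t_step, mem_upair; right; reflexivity]);
    apply t_step, mem_upair; auto.
Qed.

(** The first component of a pair in [t] lies in the transitive closure of [t], so the recursion on
    names is well-founded on all sets. *)
Lemma name_ind (A : V -> Prop) :
  (forall t, (forall s r, opair s r ∈ t -> A s) -> A t) -> forall t, A t.
Proof.
  intros K t. induction (wf_clos_trans _ _ mem_wf t) as [t _ IH].
  apply K. intros s r Hs. apply IH. now apply (opair_clos_trans s r).
Qed.

(** The recursive clause of [forces_eq] with the relation abstracted, so that other relations can be
    tested for satisfying it. *)
Definition eq_clause (E : V -> V -> V -> Prop) (p t1 t2 : V) : Prop :=
  (forall s1 r1, opair s1 r1 ∈ t1 -> forall q, ple P p q ->
     exists r, ple P q r /\
       (ple P r1 r -> exists s2 r2, opair s2 r2 ∈ t2 /\ ple P r2 r /\ E r s1 s2)) /\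
  (forall s2 r2, opair s2 r2 ∈ t2 -> forall q, ple P p q ->
     exists r, ple P q r /\
       (ple P r2 r -> exists s1 r1, opair s1 r1 ∈ t1 /\ ple P r1 r /\ E r s1 s2)).

Lemma forces_eq_iff p t1 t2 : forces_eq P p t1 t2 <-> eq_clause (forces_eq P) p t1 t2.
Proof. split; [intros []; split; auto | intros []; constructor; auto]. Qed.

Lemma forces_eq_mono p q t1 t2 : forces_eq P p t1 t2 -> ple P p q -> forces_eq P q t1 t2.
Proof.
  rewrite !forces_eq_iff. intros [K1 K2] L.
  split; intros s r Hs q' Hq; [apply (K1 s r) | apply (K2 s r)]; eauto using ple_trans.
Qed.

Lemma forces_eq_refl t : forall p, forces_eq P p t t.
Proof.
  induction t as [t IH] using name_ind. intros p. apply forces_eq_iff.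
  split; intros s r Hs q Hq; exists q; (split; [now apply ple_refl, (ple_cond p)|]);
    intros L; exists s, r; eauto.
Qed.

Lemma forces_eq_sym t1 : forall t2 p, forces_eq P p t1 t2 -> forces_eq P p t2 t1.
Proof.
  induction t1 as [t1 IH] using name_ind. intros t2 p. rewrite !forces_eq_iff. intros [K1 K2].
  split; intros s r Hs q Hq; [destruct (K2 s r Hs q Hq) as [r' [L M]]
                             |destruct (K1 s r Hs q Hq) as [r' [L M]]];
  exists r'; (split; [auto|]); intros N; destruct (M N) as [s' [r'' [M1 [M2 M3]]]];
  exists s', r''; eauto.
Qed.

(** An element of one outer name is followed through [t2] into the other outer name, strengthening
    the condition at each of the two passages. *)
Lemma forces_eq_trans t1 : forall t2 t3 p,
  forces_eq P p t1 t2 -> forces_eq P p t2 t3 -> forces_eq P p t1 t3.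
Proof.
  induction t1 as [t1 IH] using name_ind. intros t2 t3 p.
  rewrite !forces_eq_iff. intros [K1 K2] [L1 L2]. split.
  - intros s1 r1 Hs q Hq. destruct (K1 s1 r1 Hs q Hq) as [r [R1 R2]].
    (* If [r] does not extend [r1], the implication demanded at [r] is vacuous. *)
    destruct (classic (ple P r1 r)) as [C|C]; [|exists r; tauto].
    destruct (R2 C) as [s2 [r2 [A1 [A2 A3]]]].
    destruct (L1 s2 r2 A1 r) as [r' [B1 B2]]; [eauto using ple_trans|].
    exists r'; split; [eauto using ple_trans|]. intros _.
    destruct B2 as [s3 [r3 [B2 [B3 B4]]]]; [eauto using ple_trans|].
    exists s3, r3. eauto using forces_eq_mono.
  - intros s3 r3 Hs q Hq. destruct (L2 s3 r3 Hs q Hq) as [r [R1 R2]].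
    destruct (classic (ple P r3 r)) as [C|C]; [|exists r; tauto].
    destruct (R2 C) as [s2 [r2 [A1 [A2 A3]]]].
    destruct (K2 s2 r2 A1 r) as [r' [B1 B2]]; [eauto using ple_trans|].
    exists r'; split; [eauto using ple_trans|]. intros _.
    destruct B2 as [s1 [r1 [B2 [B3 B4]]]]; [eauto using ple_trans|].
    exists s1, r1. eauto using forces_eq_mono.
Qed.

Lemma f_mem_mono s t p q : f_mem P s t p -> ple P p q -> f_mem P s t q.
Proof. intros K L q' Hq. apply K. eauto using ple_trans. Qed.

Lemma f_mem_forces_eq s t t' p : f_mem P s t p -> forces_eq P p t t' -> f_mem P s t' p.
Proof.
  intros K E q Hq. destruct (K q Hq) as [r [R1 [s' [r' [R2 [R3 R4]]]]]].
  apply forces_eq_iff in E. destruct (proj1 E s' r' R2 r) as [r2 [A1 A2]];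
    [eauto using ple_trans|].
  exists r2; split; [eauto using ple_trans|].
  destruct A2 as [s2 [r3 [A2 [A3 A4]]]]; [eauto using ple_trans|].
  exists s2, r3. eauto using forces_eq_trans, forces_eq_mono.
Qed.

(** Membership induction: an element of one check name must equal, below some condition, the check
    name of an element of the other set. *)
Lemma forces_eq_check x : forall y p, cond P p ->
  forces_eq P p (check P x) (check P y) -> x = y.
Proof.
  induction (mem_wf x) as [x _ IH]. intros y p Hp E.
  apply forces_eq_iff in E. destruct E as [K1 K2].
  apply set_ext; intros z; split; intros Hz.
  (* The pair of [check P z] with [p] itself is used, so that the premise of the clause holds at
     every extension of [p]. *)
  - destruct (K1 (check P z) p) with (q := p) as [r [R1 R2]];
      [apply mem_check; eauto | now apply ple_refl |].
    destruct (R2 R1) as [s2 [r2 [A1 [A2 A3]]]]. apply mem_check in A1.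
    destruct A1 as [w [c [B1 [B2 B3]]]]. apply opair_inj in B3. destruct B3 as [-> ->].
    now rewrite (IH z Hz w r (proj2 (ple_cond _ _ R1)) A3).
  - destruct (K2 (check P z) p) with (q := p) as [r [R1 R2]];
      [apply mem_check; eauto | now apply ple_refl |].
    destruct (R2 R1) as [s2 [r2 [A1 [A2 A3]]]]. apply mem_check in A1.
    destruct A1 as [w [c [B1 [B2 B3]]]]. apply opair_inj in B3. destruct B3 as [-> ->].
    now rewrite <- (IH w B1 z r (proj2 (ple_cond _ _ R1)) A3).
Qed.

Lemma mem_Gdot z : z ∈ Gdot P <-> exists c, cond P c /\ z = opair (check P c) c.
Proof.
  unfold Gdot. rewrite mem_vset. split.
  - intros [i ->]. exists (fam (f_car P) i). split; [apply mem_fam|auto].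
  - intros [c [[i ->] ->]]. now exists i.
Qed.

Lemma f_mem_Gdot_intro d p : ple P d p -> f_mem P (check P d) (Gdot P) p.
Proof.
  intros L q Hq. exists q. split; [now apply ple_refl, (ple_cond p)|].
  exists (check P d), d. split; [|split].
  - apply mem_Gdot. exists d; split; [now apply (ple_cond d p)|auto].
  - eauto using ple_trans.
  - apply forces_eq_refl.
Qed.

(** Separativity is not assumed, so [p] need not extend [c]. The pair of [Gdot] found below [p]
    carries the condition [c], because check names determine their sets. *)
Lemma f_mem_Gdot_elim c p : cond P p -> f_mem P (check P c) (Gdot P) p ->
  exists r, ple P p r /\ ple P c r.
Proof.
  intros Hp K. destruct (K p (ple_refl _ Hp)) as [r [R1 [s [c' [A1 [A2 A3]]]]]].
  exists r; split; [auto|]. apply mem_Gdot in A1. destruct A1 as [d [_ E]].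
  apply opair_inj in E. destruct E as [-> ->].
  now rewrite (forces_eq_check _ _ _ (proj2 (ple_cond _ _ R1)) A3).
Qed.

End Forcing.

(** * Definability and elementary submodels *)

Section Definability.

Variable H : V -> Prop.
Variable R : V -> V -> Prop.
Hypothesis H_trans : forall x y, H x -> y ∈ x -> H y.
Hypothesis H_upair : forall x y, H x -> H y -> H (upair x y).

Definition definable (Q : (nat -> V) -> Prop) : Prop :=
  exists f, forall e, (forall i, H (e i)) -> (Q e <-> sat H R f e).

Lemma definable_ext (Q Q' : (nat -> V) -> Prop) :
  (forall e, (forall i, H (e i)) -> (Q e <-> Q' e)) -> definable Q -> definable Q'.
Proof. intros E [f F]. exists f. intros e He. rewrite <- E; auto. Qed.

Lemma definable_mem i j : definable (fun e => e i ∈ e j).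
Proof. exists (FMem i j). simpl; tauto. Qed.

Lemma definable_eq i j : definable (fun e => e i = e j).
Proof. exists (FEq i j). simpl; tauto. Qed.

Lemma definable_not Q : definable Q -> definable (fun e => ~ Q e).
Proof. intros [f F]. exists (FNot f). intros e He. simpl. now rewrite F. Qed.

Lemma definable_and Q Q' : definable Q -> definable Q' -> definable (fun e => Q e /\ Q' e).
Proof. intros [f F] [g G]. exists (FAnd f g). intros e He. simpl. now rewrite F, G. Qed.

Lemma definable_imp (Q Q' : (nat -> V) -> Prop) :
  definable Q -> definable Q' -> definable (fun e => Q e -> Q' e).
Proof.
  intros D D'. apply (definable_ext (fun e => ~ (Q e /\ ~ Q' e))).
  - intros e _. tauto.
  - now apply definable_not, definable_and, definable_not.
Qed.

Lemma definable_or Q Q' : definable Q -> definable Q' -> definable (fun e => Q e \/ Q' e).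
Proof.
  intros D D'. apply (definable_ext (fun e => ~ (~ Q e /\ ~ Q' e))).
  - intros e _. tauto.
  - now apply definable_not, definable_and; apply definable_not.
Qed.

Lemma definable_iff Q Q' : definable Q -> definable Q' -> definable (fun e => Q e <-> Q' e).
Proof. intros D D'. apply definable_and; now apply definable_imp. Qed.

(** The bound variable takes index 0 and the indices of the parameters shift by one. *)
Lemma definable_all (Q : (nat -> V) -> V -> Prop) :
  definable (fun e => Q (fun i => e (S i)) (e 0)) ->
  definable (fun e => forall x, H x -> Q e x).
Proof.
  intros [f F]. exists (FAll f). intros e He. simpl.
  split; intros K x Hx.
  - apply F; [intros [|i]; simpl; auto|]. exact (K x Hx).
  - apply (F (scons x e)); [intros [|i]; simpl; auto|]. exact (K x Hx).
Qed.

Lemma definable_ex (Q : (nat -> V) -> V -> Prop) :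
  definable (fun e => Q (fun i => e (S i)) (e 0)) ->
  definable (fun e => exists x, H x /\ Q e x).
Proof.
  intros D. apply (definable_ext (fun e => ~ forall x, H x -> ~ Q e x)).
  - intros e _. split.
    + intros K. apply NNPP. intros N. apply K. intros x Hx Qx. apply N. eauto.
    + intros [x [Hx Qx]] K. exact (K x Hx Qx).
  - apply definable_not. apply (definable_all (fun e x => ~ Q e x)).
    now apply definable_not.
Qed.

(** Since [H] is transitive, extensionality can be tested with elements of [H] alone. *)
Lemma definable_upair i j l : definable (fun e => e i = upair (e j) (e l)).
Proof.
  apply (definable_ext (fun e => forall w, H w -> (w ∈ e i <-> (w = e j \/ w = e l)))).
  - intros e He. split.
    + intros K. apply set_ext. intros w. rewrite mem_upair. split; intros Hw.
      * apply K; eauto.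
      * apply K; [|auto]. destruct Hw as [-> | ->]; auto.
    + intros -> w _. apply mem_upair.
  - apply definable_all, definable_iff; [apply definable_mem|].
    apply definable_or; apply definable_eq.
Qed.

Lemma H_opair x y : H x -> H y -> H (opair x y).
Proof. intros; repeat apply H_upair; auto. Qed.

Lemma definable_opair i j l : definable (fun e => e i = opair (e j) (e l)).
Proof.
  apply (definable_ext (fun e => exists a, H a /\ exists b, H b /\
     (a = upair (e j) (e j) /\ b = upair (e j) (e l) /\ e i = upair a b))).
  - intros e He. split.
    + intros [a [_ [b [_ [-> [-> ->]]]]]]. reflexivity.
    + intros ->. exists (upair (e j) (e j)); split; [auto|].
      exists (upair (e j) (e l)); split; [auto|]. auto.
  - apply definable_ex, definable_ex.
    apply definable_and; [|apply definable_and]; apply definable_upair.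
Qed.

Lemma definable_opair_mem i j l : definable (fun e => opair (e i) (e j) ∈ e l).
Proof.
  apply (definable_ext (fun e => exists a, H a /\ (a = opair (e i) (e j) /\ a ∈ e l))).
  - intros e He. split.
    + intros [a [_ [-> K]]]. exact K.
    + intros K. exists (opair (e i) (e j)); eauto using H_opair.
  - apply definable_ex, definable_and; [apply definable_opair|apply definable_mem].
Qed.

Lemma definable_triple_mem i j l m :
  definable (fun e => opair (e i) (opair (e j) (e l)) ∈ e m).
Proof.
  apply (definable_ext (fun e => exists a, H a /\ (a = opair (e j) (e l) /\
                                                     opair (e i) a ∈ e m))).
  - intros e He. split.
    + intros [a [_ [-> K]]]. exact K.
    + intros K. exists (opair (e j) (e l)); eauto using H_opair.
  - apply definable_ex, definable_and; [apply definable_opair|apply definable_opair_mem].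
Qed.

End Definability.

(** Builds the formula along the shape of the predicate. Every quantifier must be bounded by
    [Hered], which dictates the form of the predicates below. *)
Ltac prove_definable Hk :=
  cbv beta;
  lazymatch goal with
  | |- definable _ _ (fun e => e _ ∈ e _) => apply definable_mem
  | |- definable _ _ (fun e => e _ = e _) => apply definable_eq
  | |- definable _ _ (fun e => opair (e _) (e _) ∈ e _) =>
      apply (definable_opair_mem _ _ (Hered_mem _ Hk) (Hered_upair _ Hk))
  | |- definable _ _ (fun e => opair (e _) (opair (e _) (e _)) ∈ e _) =>
      apply (definable_triple_mem _ _ (Hered_mem _ Hk) (Hered_upair _ Hk))
  | |- definable _ _ (fun e => e _ = opair (e _) (e _)) =>
      apply (definable_opair _ _ (Hered_mem _ Hk) (Hered_upair _ Hk))
  | |- definable _ _ (fun e => @?A e <-> @?B e) =>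
      apply (definable_iff _ _ A B); prove_definable Hk
  | |- definable _ _ (fun e => @?A e /\ @?B e) =>
      apply (definable_and _ _ A B); prove_definable Hk
  | |- definable _ _ (fun e => @?A e \/ @?B e) =>
      apply (definable_or _ _ A B); prove_definable Hk
  | |- definable _ _ (fun e => ~ @?A e) => apply (definable_not _ _ A); prove_definable Hk
  | |- definable _ _ (fun e => exists x, Hered _ x /\ @?A e x) =>
      apply (definable_ex _ _ A); prove_definable Hk
  | |- definable _ _ (fun e => forall x, Hered _ x -> @?A e x) =>
      apply (definable_all _ _ A); prove_definable Hk
  | |- definable _ _ (fun e => @?A e -> @?B e) =>
      apply (definable_imp _ _ A B); prove_definable Hk
  end.

Ltac env_in :=
  let i := fresh in
  intros i; repeat first [assumption | destruct i as [|i]; [assumption|]].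

(** * Closure properties of elementary submodels *)

Section Submodel.

Variables (W : V -> V -> V -> Prop) (k N : V).
Hypothesis Hk : regular k.
Hypothesis HN : elem_sub W k N.

Lemma Hered_sub x : x ∈ N -> Hered k x.
Proof. apply HN. Qed.

Lemma Hered_sub_mem x y : x ∈ N -> y ∈ x -> Hered k y.
Proof. intros Hx. apply Hered_mem; [exact Hk|]. now apply Hered_sub. Qed.

(** Without a witness in [N], the universal negation would hold in [N] and hence in H(k). Objects
    are placed in [N] below by describing them in H(k) and reflecting. *)
Lemma tarski_vaught Q e : definable (Hered k) (W k) Q -> (forall i, e i ∈ N) ->
  (exists x, Hered k x /\ Q (scons x e)) -> exists x, x ∈ N /\ Q (scons x e).
Proof.
  intros [f F] He [x [Hx Qx]]. destruct HN as [_ [NH El]].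
  apply NNPP. intros No.
  assert (K : sat (elts N) (W k) (FAll (FNot f)) e).
  { intros y Hy S. apply No. exists y; split; [exact Hy|].
    apply F; [intros [|i]; cbn; auto|].
    apply El; [intros [|i]; cbn; auto|exact S]. }
  apply El in K; [|exact He]. apply (K x Hx). apply F; [intros [|i]; cbn; auto|exact Qx].
Qed.

Lemma sub_empty : empty ∈ N.
Proof.
  destruct HN as [Ne _].
  assert (exists a, a ∈ N) as [a Ha].
  { apply NNPP. intros K. apply Ne. apply set_ext. intros z; split; intros Hz.
    - destruct K; eauto.
    - now apply mem_empty in Hz. }
  destruct (tarski_vaught (fun e => forall w, Hered k w -> ~ w ∈ e 0) (fun _ => a))
    as [x [Hx E]].
  - prove_definable Hk.
  - auto.
  - exists empty; split; [now apply Hered_empty|]. intros w _. apply mem_empty.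
  - cbn in E. replace empty with x; [auto|]. apply set_ext; intros z; split; intros Hz.
    + destruct (E z); [|auto]. eauto using Hered_sub_mem.
    + now apply mem_empty in Hz.
Qed.

(** The reflected set lies in the transitive class H(k), so its description there fixes all its
    elements. Pairs, numerals and finite sequences are built from this step. *)
Lemma sub_adjoin x a : x ∈ N -> a ∈ N ->
  exists y, y ∈ N /\ forall w, w ∈ y <-> w ∈ x \/ w = a.
Proof.
  intros Hx Ha.
  destruct (tarski_vaught (fun e => forall w, Hered k w -> (w ∈ e 0 <-> w ∈ e 1 \/ w = e 2))
              (scons x (fun _ => a))) as [y [Hy E]].
  - prove_definable Hk.
  - env_in.
  - cbn. destruct (Hered_class k Hk (fun w => w ∈ x \/ w = a)) as [y [K1 K2]].
    + apply small_or; [exact Hk | | now apply small_eq]. apply Hered_small; auto using Hered_sub.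
    + intros w [Hw| ->]; eauto using Hered_sub, Hered_sub_mem.
    + exists y; split; [auto|]. intros w _. apply K2.
  - cbn in E. exists y; split; [auto|]. intros w; split.
    + intros Hw. apply E; [|auto]. eauto using Hered_sub_mem.
    + intros Hw. apply E; [|auto].
      destruct Hw as [Hw| ->]; eauto using Hered_sub, Hered_sub_mem.
Qed.

Lemma sub_upair x y : x ∈ N -> y ∈ N -> upair x y ∈ N.
Proof.
  intros Hx Hy. destruct (sub_adjoin empty x sub_empty Hx) as [u [Hu U]].
  destruct (sub_adjoin u y Hu Hy) as [v [Hv K]].
  replace (upair x y) with v; [auto|]. apply set_ext; intros z.
  rewrite mem_upair, K, U. assert (M : ~ z ∈ empty) by apply mem_empty. tauto.
Qed.

Lemma sub_opair x y : x ∈ N -> y ∈ N -> opair x y ∈ N.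
Proof. intros; repeat apply sub_upair; auto. Qed.

Lemma sub_num n : num n ∈ N.
Proof.
  induction n as [|n IH]; [exact sub_empty|].
  destruct (sub_adjoin _ _ IH IH) as [u [Hu U]]. simpl.
  replace (succ (num n)) with u; [auto|]. apply set_ext; intros z.
  rewrite mem_succ. apply U.
Qed.

(** When [z] is the graph of a function, the [y] found in [N] is its value at [x]. *)
Lemma sub_apply x z : x ∈ N -> z ∈ N -> (exists y, opair x y ∈ z) ->
  exists y, y ∈ N /\ opair x y ∈ z.
Proof.
  intros Hx Hz [y Hy].
  destruct (tarski_vaught (fun e => opair (e 1) (e 0) ∈ e 2) (scons x (fun _ => z)))
    as [v [Hv E]].
  - prove_definable Hk.
  - env_in.
  - exists y; split; [|exact Hy]. eapply Hered_pair_mem; eauto using Hered_sub.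
  - cbn in E. eauto.
Qed.

Lemma sub_opair_inv x y : opair x y ∈ N -> x ∈ N /\ y ∈ N.
Proof.
  intros K. destruct (Hered_opair_inv k Hk x y (Hered_sub _ K)) as [Hx Hy]. split.
  - destruct (tarski_vaught (fun e => exists b, Hered k b /\ e 1 = opair (e 0) b)
                (fun _ => opair x y)) as [v [Hv E]].
    + prove_definable Hk.
    + env_in.
    + exists x; split; [auto|]. exists y; auto.
    + destruct E as [b [_ E]]. apply opair_inj in E. destruct E as [-> _]. exact Hv.
  - destruct (tarski_vaught (fun e => exists b, Hered k b /\ e 1 = opair b (e 0))
                (fun _ => opair x y)) as [v [Hv E]].
    + prove_definable Hk.
    + env_in.
    + exists y; split; [auto|]. exists x; auto.
    + destruct E as [b [_ E]]. apply opair_inj in E. destruct E as [_ ->]. exact Hv.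
Qed.

Lemma opair_mem_vlist i v l :
  opair (num i) v ∈ vlist l <-> i < length l /\ v = nth i l empty.
Proof.
  unfold vlist. rewrite mem_vset. split.
  - intros [[j Hj] E]. apply opair_inj in E. destruct E as [E ->].
    apply num_inj in E. subst. auto.
  - intros [Hi ->]. now exists (exist _ i Hi).
Qed.

(** Appending an entry adjoins one pair to the code. Conversely an entry is the value of the code, a
    function, at a numeral. *)
Lemma sub_vlist l : Forall (fun v => v ∈ N) l <-> vlist l ∈ N.
Proof.
  split.
  - induction l as [|a l IH] using rev_ind; intros K.
    + replace (vlist []) with empty; [apply sub_empty|].
      apply set_ext; intros z; split; intros Hz; [now apply mem_empty in Hz|].
      unfold vlist in Hz. rewrite mem_vset in Hz. destruct Hz as [[i Hi] _]. simpl in Hi. lia.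
    + apply Forall_app in K. destruct K as [Kl Ka]. inversion_clear Ka as [|? ? Ha _].
      destruct (sub_adjoin (vlist l) (opair (num (length l)) a)) as [y [Hy E]];
        [auto | auto using sub_opair, sub_num |].
      replace (vlist (l ++ [a])) with y; [auto|]. apply set_ext; intros z.
      rewrite E. unfold vlist. rewrite !mem_vset. split.
      * intros [[[i Hi] ->]| ->]; simpl.
        -- assert (L : i < length (l ++ [a])) by (rewrite length_app; lia).
           exists (exist _ i L). simpl. now rewrite app_nth1.
        -- assert (L : length l < length (l ++ [a])) by (rewrite length_app; simpl; lia).
           exists (exist _ (length l) L). simpl. now rewrite nth_middle.
      * intros [[i Hi] ->]; simpl. rewrite length_app in Hi; simpl in Hi.
        destruct (Nat.eq_dec i (length l)) as [->|Ne].
        -- right. now rewrite nth_middle.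
        -- left. assert (L : i < length l) by lia. exists (exist _ i L). simpl.
           now rewrite app_nth1.
  - intros K. apply Forall_forall. intros v Hv.
    destruct (In_nth _ _ empty Hv) as [i [Hi E]].
    destruct (sub_apply (num i) (vlist l)) as [w [Hw Kw]].
    + apply sub_num.
    + auto.
    + exists v. now apply opair_mem_vlist.
    + apply opair_mem_vlist in Kw. destruct Kw as [_ ->]. now rewrite <- E.
Qed.

(** Reduces the demand that positions belong to [N] to the membership in [N] of the conditions
    played. *)
Lemma position_in_iff s : position_in N s <-> Forall (Forall (fun v => v ∈ N)) s.
Proof.
  unfold position_in. rewrite <- sub_vlist, Forall_map.
  split; apply Forall_impl; intros m; apply sub_vlist.
Qed.

End Submodel.

(** * Forcing inside an elementary submodel *)

(* The recursive clauses of the forcing relation as first-order properties of the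
   structure [H]: all quantifiers are bounded by it. *)
Definition eq_clause_in (H : V -> Prop) (le : V) (E : V -> V -> V -> Prop) (p t1 t2 : V) : Prop :=
  (forall s1, H s1 -> forall r1, H r1 -> opair s1 r1 ∈ t1 -> forall q, H q -> opair p q ∈ le ->
     exists r, H r /\ (opair q r ∈ le /\
       (opair r1 r ∈ le -> exists s2, H s2 /\ exists r2, H r2 /\
          (opair s2 r2 ∈ t2 /\ opair r2 r ∈ le /\ E r s1 s2)))) /\
  (forall s2, H s2 -> forall r2, H r2 -> opair s2 r2 ∈ t2 -> forall q, H q -> opair p q ∈ le ->
     exists r, H r /\ (opair q r ∈ le /\
       (opair r2 r ∈ le -> exists s1, H s1 /\ exists r1, H r1 /\
          (opair s1 r1 ∈ t1 /\ opair r1 r ∈ le /\ E r s1 s2)))).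

Definition f_mem_in (H : V -> Prop) (le : V) (E : V -> V -> V -> Prop) (s t p : V) : Prop :=
  forall q, H q -> opair p q ∈ le ->
    exists r, H r /\ (opair q r ∈ le /\ exists s', H s' /\ exists r', H r' /\
      (opair s' r' ∈ t /\ opair r' r ∈ le /\ E r s s')).

(** The clause consults the relation only at extensions of [p] and at first components of elements
    of [t1] and [t2]. This locality makes induction on names available. *)
Lemma eq_clause_ext P (E E' : V -> V -> V -> Prop) p t1 t2 :
  (forall r s1 r1 s2 r2, ple P p r -> opair s1 r1 ∈ t1 -> opair s2 r2 ∈ t2 ->
     (E r s1 s2 <-> E' r s1 s2)) ->
  eq_clause P E p t1 t2 -> eq_clause P E' p t1 t2.
Proof.
  intros EE [K1 K2]. split.
  - intros s1 r1 Hs q Hq. destruct (K1 s1 r1 Hs q Hq) as [r [A B]].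
    exists r; split; [auto|]. intros L. destruct (B L) as [s2 [r2 [B1 [B2 B3]]]].
    exists s2, r2. split; [|split]; auto.
    apply (EE r s1 r1 s2 r2); eauto using ple_trans.
  - intros s2 r2 Hs q Hq. destruct (K2 s2 r2 Hs q Hq) as [r [A B]].
    exists r; split; [auto|]. intros L. destruct (B L) as [s1 [r1 [B1 [B2 B3]]]].
    exists s1, r1. split; [|split]; auto.
    apply (EE r s1 r1 s2 r2); eauto using ple_trans.
Qed.

(** All quantified objects are components of pairs in [f_le P], [t1] or [t2], hence belong to
    H(k). *)
Lemma eq_clause_in_iff k P E p t1 t2 : regular k ->
  Hered k (f_le P) -> Hered k t1 -> Hered k t2 ->
  (eq_clause_in (Hered k) (f_le P) E p t1 t2 <-> eq_clause P E p t1 t2).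
Proof.
  intros Hk Hl H1 H2.
  pose proof (fun x y => Hered_pair_mem k Hk x y _ Hl) as Pl.
  pose proof (fun x y => Hered_pair_mem k Hk x y _ H1) as P1.
  pose proof (fun x y => Hered_pair_mem k Hk x y _ H2) as P2.
  split; intros [K1 K2]; split.
  - intros s1 r1 Hs q Hq. destruct (P1 _ _ Hs), (Pl _ _ Hq).
    destruct (K1 s1) with (r1 := r1) (q := q) as [r [_ [A B]]]; auto.
    exists r; split; [auto|]. intros L.
    destruct (B L) as [s2 [_ [r2 [_ [B1 [B2 B3]]]]]]. eauto.
  - intros s2 r2 Hs q Hq. destruct (P2 _ _ Hs), (Pl _ _ Hq).
    destruct (K2 s2) with (r2 := r2) (q := q) as [r [_ [A B]]]; auto.
    exists r; split; [auto|]. intros L.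
    destruct (B L) as [s1 [_ [r1 [_ [B1 [B2 B3]]]]]]. eauto.
  - intros s1 _ r1 _ Hs q _ Hq. destruct (K1 s1 r1 Hs q Hq) as [r [A B]].
    exists r; split; [apply (Pl q r A)|]. split; [auto|]. intros L.
    destruct (B L) as [s2 [r2 [B1 [B2 B3]]]].
    exists s2; split; [apply (P2 _ _ B1)|]. exists r2; split; [apply (P2 _ _ B1)|]. auto.
  - intros s2 _ r2 _ Hs q _ Hq. destruct (K2 s2 r2 Hs q Hq) as [r [A B]].
    exists r; split; [apply (Pl q r A)|]. split; [auto|]. intros L.
    destruct (B L) as [s1 [r1 [B1 [B2 B3]]]].
    exists s1; split; [apply (P1 _ _ B1)|]. exists r1; split; [apply (P1 _ _ B1)|]. auto.
Qed.

Lemma f_mem_in_iff k P (E : V -> V -> V -> Prop) s t p : regular k ->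
  Hered k (f_le P) -> Hered k t ->
  (forall r s' r', ple P p r -> opair s' r' ∈ t -> (E r s s' <-> forces_eq P r s s')) ->
  (f_mem_in (Hered k) (f_le P) E s t p <-> f_mem P s t p).
Proof.
  intros Hk Hl Ht EE.
  pose proof (fun x y => Hered_pair_mem k Hk x y _ Hl) as Pl.
  pose proof (fun x y => Hered_pair_mem k Hk x y _ Ht) as Pt.
  split.
  - intros K q Hq. destruct (K q) as [r [_ [A [s' [_ [r' [_ [B1 [B2 B3]]]]]]]]];
      [apply (Pl p q Hq) | auto |].
    exists r; split; [auto|]. exists s', r'. split; [|split]; auto.
    eapply EE; eauto using ple_trans.
  - intros K q _ Hq. destruct (K q Hq) as [r [A [s' [r' [B1 [B2 B3]]]]]].
    exists r; split; [apply (Pl q r A)|]. split; [auto|].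
    exists s'; split; [apply (Pt _ _ B1)|]. exists r'; split; [apply (Pt _ _ B1)|].
    split; [|split]; auto. eapply EE; eauto using ple_trans.
Qed.

Section SubmodelForcing.

Variables (W : V -> V -> V -> Prop) (k N : V).
Hypothesis Hk : regular k.
Hypothesis HN : elem_sub W k N.
Variable P : forcing.
Hypothesis HcarN : f_car P ∈ N.
Hypothesis HleN : f_le P ∈ N.

(** Provides a domain in [N] for the forcing of equality. With [c] the graph of the check operation,
    it contains [t] and the check names to be compared with its subnames. *)
Lemma sub_name_closure t c : t ∈ N -> c ∈ N ->
  exists M, M ∈ N /\ t ∈ M /\ (forall s w, opair s w ∈ c -> w ∈ M) /\
    (forall u s r, u ∈ M -> opair s r ∈ u -> s ∈ M).
Proof.
  intros Ht Hc.
  assert (Hht := Hered_sub _ _ _ HN _ Ht). assert (Hhc := Hered_sub _ _ _ HN _ Hc).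
  destruct (tarski_vaught W k N HN (fun e =>
     e 1 ∈ e 0 /\
     (forall s, Hered k s -> forall w, Hered k w -> opair s w ∈ e 2 -> w ∈ e 0) /\
     (forall u, Hered k u -> forall s, Hered k s -> forall r, Hered k r ->
        u ∈ e 0 -> opair s r ∈ u -> s ∈ e 0)) (scons t (fun _ => c))) as [M [HM E]].
  - prove_definable Hk.
  - env_in.
  - cbn. destruct (Hered_class k Hk (fun y => y = t \/ clos_trans V mem y t \/ clos_trans V mem y c))
      as [M [HM E]].
    + apply small_or; [auto|now apply small_eq|].
      apply small_or; [auto| |]; now apply small_card_lt.
    + intros y [-> | [K|K]]; [auto| |]; (eapply Hered_clos_trans; [exact Hk| |exact K]; auto).
    + exists M; split; [auto|]. split; [apply E; auto|]. split.
      * intros s _ w _ K. apply E. right; right. now apply (opair_clos_trans s w).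
      * intros u _ s _ r _ Hu Hs. apply opair_clos_trans in Hs. destruct Hs as [Hs _]. apply E. apply E in Hu.
        destruct Hu as [-> | [K|K]]; eauto using Relation_Operators.t_trans.
  - cbn in E. destruct E as [E1 [E2 E3]].
    exists M; split; [auto|]. split; [auto|]. split.
    + intros s w K. destruct (Hered_pair_mem k Hk s w c Hhc K) as [Hs Hw]. exact (E2 s Hs w Hw K).
    + intros u s r Hu K. assert (Hhu := Hered_sub_mem W k N Hk HN _ _ HM Hu).
      destruct (Hered_pair_mem k Hk s r u Hhu K) as [Hs Hr]. exact (E3 u Hhu s Hs r Hr Hu K).
Qed.

(* The recursive clause determines the forcing of equality between elements of [M],
   so any set in [N] that satisfies it is the right one. *)
Lemma sub_forces_eq M : M ∈ N -> (forall u s r, u ∈ M -> opair s r ∈ u -> s ∈ M) ->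
  exists K, K ∈ N /\ forall r t1 t2, cond P r -> t1 ∈ M -> t2 ∈ M ->
    (opair r (opair t1 t2) ∈ K <-> forces_eq P r t1 t2).
Proof.
  intros HM Mc.
  assert (Hhc := Hered_sub _ _ _ HN _ HcarN). assert (Hhl := Hered_sub _ _ _ HN _ HleN).
  assert (HhM := fun x => Hered_sub_mem W k N Hk HN M x HM).
  assert (HhP := fun x => Hered_sub_mem W k N Hk HN _ x HcarN).
  destruct (tarski_vaught W k N HN (fun e =>
     forall r, Hered k r -> forall t1, Hered k t1 -> forall t2, Hered k t2 ->
       r ∈ e 2 -> t1 ∈ e 1 -> t2 ∈ e 1 ->
       (opair r (opair t1 t2) ∈ e 0 <->
        eq_clause_in (Hered k) (e 3) (fun r t1 t2 => opair r (opair t1 t2) ∈ e 0) r t1 t2))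
     (scons M (scons (f_car P) (fun _ => f_le P)))) as [K [HK E]].
  - unfold eq_clause_in. prove_definable Hk.
  - env_in.
  (* The witness in H(k) is the true forcing relation restricted to [M]. *)
  - cbn. destruct (Hered_class k Hk (fun z => exists r t1 t2, cond P r /\ t1 ∈ M /\ t2 ∈ M /\
        forces_eq P r t1 t2 /\ z = opair r (opair t1 t2))) as [K [HK E]].
    + apply (small_sub k _ (fun z => exists r, elts (f_car P) r /\ exists w,
         (exists t1, elts M t1 /\ exists t2, elts M t2 /\ w = opair t1 t2) /\ z = opair r w)).
      * intros z [r [t1 [t2 [A [B [C [_ ->]]]]]]]. exists r; split; [auto|].
        exists (opair t1 t2); split; [|auto]. exists t1; split; [auto|]. exists t2; auto.
      * assert (SM : small k (elts M)) by (apply Hered_small; eauto using Hered_sub).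
        apply small_image2; [auto|now apply Hered_small|]. now apply small_image2.
    + intros z [r [t1 [t2 [A [B [C [_ ->]]]]]]]. apply Hered_opair; auto.
      apply Hered_opair; auto.
    + exists K; split; [auto|]. intros r _ t1 _ t2 _ Hr H1 H2.
      assert (KE : forall r s1 s2, cond P r -> s1 ∈ M -> s2 ∈ M ->
                (opair r (opair s1 s2) ∈ K <-> forces_eq P r s1 s2)).
      { intros q s1 s2 Hq Hs1 Hs2. rewrite E. split.
        - intros [r' [a [b [_ [_ [_ [F Eq]]]]]]]. apply opair_inj in Eq.
          destruct Eq as [-> Eq]. apply opair_inj in Eq. now destruct Eq as [-> ->].
        - intros F. exists q, s1, s2; auto. }
      rewrite eq_clause_in_iff; auto. rewrite KE by auto. rewrite forces_eq_iff.
      split; apply eq_clause_ext; intros r' s1 r1 s2 r2 L S1 S2; [symmetry|];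
        apply KE; eauto; now apply (ple_cond P r r').
  (* The condition and [t2] stay general in the induction, because the clause passes to stronger
     conditions and to subnames of [t2]. *)
  - exists K; split; [auto|]. intros r t1 t2 Hr H1. cbn in E. revert r t2 Hr H1.
    induction t1 as [t1 IH] using name_ind. intros r t2 Hr H1 H2.
    rewrite E; auto. rewrite eq_clause_in_iff; auto. rewrite forces_eq_iff.
    split; apply eq_clause_ext; intros r' s1 r1 s2 r2 L S1 S2; [|symmetry];
      apply (IH s1 r1); eauto; now apply (ple_cond P r r').
Qed.

Variables X c : V.
Hypothesis HXN : X ∈ N.
Hypothesis HcN : c ∈ N.
Hypothesis c_spec : forall s w, opair s w ∈ c <-> s ∈ X /\ w = check P s.

(** With the set [K] for equality, forced membership in [t] becomes first-order over parameters in
    [N]. The set of possible elements and a condition forcing a given one can then both be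
    reflected. *)
Lemma sub_forced_elements t p : t ∈ N -> p ∈ N -> cond P p ->
  (exists E, E ∈ N /\ forall s, s ∈ E <->
     s ∈ X /\ exists q, ple P p q /\ f_mem P (check P s) t q) /\
  (forall s, s ∈ X -> s ∈ N -> (exists q, ple P p q /\ f_mem P (check P s) t q) ->
     exists q, q ∈ N /\ ple P p q /\ f_mem P (check P s) t q).
Proof.
  intros Ht Hp Cp.
  destruct (sub_name_closure t c Ht HcN) as [M [HM [M1 [M2 M3]]]].
  destruct (sub_forces_eq M HM M3) as [K [HK E]].
  assert (Hht := Hered_sub _ _ _ HN _ Ht). assert (Hhl := Hered_sub _ _ _ HN _ HleN).
  assert (F : forall s q, s ∈ X -> cond P q ->
     (f_mem_in (Hered k) (f_le P) (fun r u v => opair r (opair u v) ∈ K) (check P s) t q <->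
      f_mem P (check P s) t q)).
  { intros s q Hs Cq. apply f_mem_in_iff; auto. intros r s' r' L Hs'. apply E.
    - now apply (ple_cond P q r).
    - apply (M2 s). now apply c_spec.
    - eauto. }
  assert (HhX := fun x => Hered_sub_mem W k N Hk HN X x HXN).
  split.
  (* Index 0 is the set sought, and 1 to 6 are [X], [c], [f_le P], [t], [p] and [K]. The check name
     of [s] enters as the value of [c] at [s]. *)
  - destruct (tarski_vaught W k N HN (fun e =>
      forall s, Hered k s -> (s ∈ e 0 <-> s ∈ e 1 /\ exists w, Hered k w /\ (opair s w ∈ e 2 /\
        exists q, Hered k q /\ (opair (e 5) q ∈ e 3 /\
          f_mem_in (Hered k) (e 3) (fun r u v => opair r (opair u v) ∈ e 6) w (e 4) q))))
      (scons X (scons c (scons (f_le P) (scons t (scons p (fun _ => K))))))) as [A [HA EA]].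
    + unfold f_mem_in. prove_definable Hk.
    + env_in.
    + cbn. destruct (Hered_class k Hk (fun s => s ∈ X /\
        exists q, ple P p q /\ f_mem P (check P s) t q)) as [A [HA EA]].
      * apply (small_sub k _ (elts X)); [now intros s [? _]|].
        apply Hered_small; eauto using Hered_sub.
      * intros s [Hs _]. auto.
      * exists A; split; [auto|]. intros s _. rewrite EA. split.
        -- intros [Hs [q [L Q]]]. split; [auto|]. exists (check P s).
           assert (K1 : opair s (check P s) ∈ c) by now apply c_spec.
           split; [eapply (Hered_pair_mem k Hk); [|exact K1]; eauto using Hered_sub|].
           split; [auto|]. exists q. split; [apply (Hered_pair_mem k Hk _ _ _ Hhl L)|].
           split; [auto|]. apply F; auto. now apply (ple_cond P p q).
        -- intros [Hs [w [_ [K1 [q [_ [L Q]]]]]]]. split; [auto|]. exists q.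
           apply c_spec in K1. destruct K1 as [_ ->]. split; [auto|]. apply F; auto.
           now apply (ple_cond P p q).
    + cbn in EA. exists A; split; [auto|]. intros s. split.
      * intros Hs. apply EA in Hs; [|eauto using Hered_sub_mem].
        destruct Hs as [Hs [w [_ [K1 [q [_ [L Q]]]]]]]. split; [auto|]. exists q.
        apply c_spec in K1. destruct K1 as [_ ->]. split; [auto|]. apply F; auto.
        now apply (ple_cond P p q).
      * intros [Hs [q [L Q]]]. apply EA; auto. split; [auto|]. exists (check P s).
        assert (K1 : opair s (check P s) ∈ c) by now apply c_spec.
        split; [eapply (Hered_pair_mem k Hk); [|exact K1]; eauto using Hered_sub|].
        split; [auto|]. exists q. split; [apply (Hered_pair_mem k Hk _ _ _ Hhl L)|].
        split; [auto|]. apply F; auto. now apply (ple_cond P p q).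
  - intros s Hs HsN [q [L Q]].
    assert (K1 : opair s (check P s) ∈ c) by now apply c_spec.
    (* The check name of [s] belongs to [N] as the value of [c] at [s]. *)
    destruct (sub_apply W k N Hk HN s c HsN HcN) as [w [HwN Hw]]; [eauto|].
    apply c_spec in Hw. destruct Hw as [_ ->].
    destruct (tarski_vaught W k N HN (fun e => opair (e 1) (e 0) ∈ e 2 /\
       f_mem_in (Hered k) (e 2) (fun r u v => opair r (opair u v) ∈ e 5) (e 3) (e 4) (e 0))
       (scons p (scons (f_le P) (scons (check P s) (scons t (fun _ => K)))))) as [r [HrN [R1 R2]]].
    + unfold f_mem_in. prove_definable Hk.
    + env_in.
    + cbn. exists q. split; [apply (Hered_pair_mem k Hk _ _ _ Hhl L)|]. split; [auto|].
      apply F; auto. now apply (ple_cond P p q).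
    + cbn in R1, R2. exists r; split; [auto|]. split; [auto|]. apply F; auto.
      now apply (ple_cond P p r).
Qed.

Lemma sub_dense D p : D ∈ N -> f_dense P D -> p ∈ N -> cond P p ->
  exists d, d ∈ N /\ d ∈ D /\ ple P p d.
Proof.
  intros HD [_ Dd] Hp Cp. destruct (Dd p Cp) as [q [Q1 Q2]].
  destruct (tarski_vaught W k N HN (fun e => e 0 ∈ e 1 /\ opair (e 2) (e 0) ∈ e 3)
     (scons D (scons p (fun _ => f_le P)))) as [r [HrN [R1 R2]]].
  - prove_definable Hk.
  - env_in.
  - exists q; split; [|auto]. eauto using Hered_sub_mem.
  - exists r; auto.
Qed.

End SubmodelForcing.

(** * Check names and levels as elements of H(k) *)

Lemma card_le_trans (A B C : V -> Prop) : card_le A B -> card_le B C -> card_le A C.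
Proof.
  intros [f [f1 f2]] [g [g1 g2]]. exists (fun x => g (f x)). split; auto.
Qed.

Lemma omega1_transitive : transitive_set omega1.
Proof.
  intros a Ha b Hb. apply omega1P in Ha. apply omega1P. destruct Ha as [Oa Ca].
  split; [eapply ordinal_mem; eauto|]. apply (card_le_trans _ (elts a)); [|exact Ca].
  exists (fun x => x). split; [|auto]. intros x Hx. exact (proj1 Oa b Hb x Hx).
Qed.

Section HereditaryCodes.

Variable k : V.
Hypothesis Hk : regular k.

(** Every element of [omega1] is a subset of it and so is small; membership induction does the
    rest. *)
Lemma Hered_omega1 : small k (elts omega1) -> Hered k omega1.
Proof.
  intros S.
  assert (K : forall a, a ∈ omega1 -> Hered k a).
  { intros a. induction (mem_wf a) as [a _ IH]. intros Ha. apply Hered_intro; [auto| |].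
    - revert S. apply small_sub. intros b Hb. exact (omega1_transitive a Ha b Hb).
    - intros b Hb. apply IH; [auto|]. exact (omega1_transitive a Ha b Hb). }
  apply Hered_intro; auto.
Qed.

Lemma check_graph P X : Hered k (f_car P) -> Hered k X ->
  exists c, Hered k c /\ forall s w, opair s w ∈ c <-> s ∈ X /\ w = check P s.
Proof.
  intros HP HX.
  destruct (Hered_class k Hk (fun z => exists s, elts X s /\ z = opair s (check P s)))
    as [c [Hc C]].
  - apply small_image; [auto|]. now apply Hered_small.
  - intros z [s [Hs ->]]. assert (Hered k s) by (eapply Hered_mem; eassumption).
    apply Hered_opair; [auto|auto|]. now apply Hered_check.
  - exists c; split; [auto|]. intros s w. rewrite C. split.
    + intros [s' [Hs E]]. apply opair_inj in E. destruct E as [-> ->]. auto.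
    + intros [Hs ->]. exists s; auto.
Qed.

(** Choose injections of the levels into [omega] and let [c] send a level and a number to the node
    with that number. A model containing [c] and the level then contains the node. *)
Lemma level_enumeration T : omega1_tree T -> Hered k (t_car T) ->
  exists c, Hered k c /\
    (forall a s, a ∈ omega1 -> on_level T a s -> exists n, opair (opair a (num n)) s ∈ c) /\
    (forall u s s', opair u s ∈ c -> opair u s' ∈ c -> s = s').
Proof.
  intros [_ [Cw [_ [Lv _]]]] HT.
  pose (spec := fun a (f : V -> V) => (forall s, on_level T a s -> elts omega (f s)) /\
     (forall s s', on_level T a s -> on_level T a s' -> f s = f s' -> s = s')).
  pose (g := fun a => epsilon (inhabits (fun x => x)) (spec a)).
  assert (G : forall a, a ∈ omega1 -> spec a (g a)).
  { intros a Ha. apply (epsilon_spec (inhabits (fun x => x)) (spec a)). exact (Lv a Ha). }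
  assert (ST : small k (elts (t_car T))) by now apply Hered_small.
  (* [omega1] is small because it injects into the tree. *)
  assert (So : small k (elts omega1)) by (intros K; apply ST; eapply card_le_trans; eauto).
  destruct (Hered_class k Hk (fun z => exists a, elts omega1 a /\ exists s,
     on_level T a s /\ z = opair (opair a (g a s)) s)) as [c [Hc C]].
  - apply (small_sub k _ (fun z => exists a, elts omega1 a /\ exists s,
       elts (t_car T) s /\ z = opair (opair a (g a s)) s)).
    + intros z [a [Ha [s [[Hs _] E]]]]. exists a; split; [auto|]. exists s; auto.
    + now apply (small_image2 k Hk _ _ (fun a s => opair (opair a (g a s)) s)).
  - intros z [a [Ha [s [Hs ->]]]].
    assert (Hered k s) by (eapply Hered_mem; [exact Hk|exact HT|apply Hs]).
    assert (Hered k a) by (eapply Hered_mem; [exact Hk|now apply Hered_omega1|exact Ha]).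
    apply Hered_opair; [auto| |auto]. apply Hered_opair; [auto|auto|].
    destruct (G a Ha) as [G1 _]. destruct (proj1 (mem_vset _ _) (G1 s Hs)) as [n ->].
    now apply Hered_num.
  - exists c; split; [auto|]. split.
    + intros a s Ha Hs. destruct (G a Ha) as [G1 _].
      destruct (proj1 (mem_vset _ _) (G1 s Hs)) as [n Hn].
      exists n. apply C. exists a; split; [auto|]. exists s; split; [auto|]. now rewrite Hn.
    + intros u s s' K K'. apply C in K, K'.
      destruct K as [a [Ha [r [Hr E]]]], K' as [a' [Ha' [r' [Hr' E']]]].
      apply opair_inj in E, E'. destruct E as [-> ->], E' as [E' ->].
      apply opair_inj in E'. destruct E' as [<- E']. now apply (proj2 (G a Ha)).
Qed.

End HereditaryCodes.

Lemma tlt_mem T s t : tlt T s t -> s ∈ t_car T.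
Proof.
  intros K. destruct (t_lt_sub T K) as [s' [t' [H1 [_ E]]]].
  apply opair_inj in E. now destruct E as [-> _].
Qed.

(** The isomorphism of [d] with the predecessors of [t], restricted to the index [i] of [s],
    enumerates the predecessors of [s]. *)
Lemma on_level_pred T d t s : on_level T d t -> tlt T s t ->
  exists i, i ∈ d /\ on_level T i s.
Proof.
  intros [_ [Od [f [F1 [F2 F3]]]]] L. destruct (F2 s L) as [i [Hi ->]].
  exists i; split; [auto|]. split; [now apply (tlt_mem T _ t)|].
  split; [now apply (ordinal_mem d)|].
  assert (I : forall j, j ∈ i -> j ∈ d) by (intros j; now apply (proj1 Od)).
  exists f. split; [|split].
  - intros j Hj. apply (F3 j i); auto.
  - intros r Hr. destruct (F2 r) as [j [Hj ->]]; [exact (Defs.t_trans T Hr L)|].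
    exists j; split; [|auto]. now apply (F3 j i).
  - auto.
Qed.

(** * The game *)

(** The position after [n] full rounds when COM follows [st] and INC answers each condition of round
    [m] by [resp m]. It is defined first because the sequences of moves depend on it. *)
Fixpoint play (st : list move -> move) (resp : nat -> V -> V) (n : nat) : list move :=
  match n with
  | 0 => []
  | S m => play st resp m ++ [st (play st resp m)] ++ [map (resp m) (st (play st resp m))]
  end.

Lemma position_odd com inc n :
  position com inc (2 * n + 1) = position com inc (2 * n) ++ [com n].
Proof.
  replace (2 * n + 1) with (S (2 * n)) by lia. cbn [position].
  now rewrite Nat.even_even, Nat.div2_double.
Qed.

Lemma position_even com inc n :
  position com inc (2 * n + 2) = position com inc (2 * n + 1) ++ [inc n].
Proof.
  replace (2 * n + 2) with (S (2 * n + 1)) by lia. cbn [position].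
  rewrite Nat.even_odd. replace (2 * n + 1) with (S (2 * n)) by lia.
  now rewrite Nat.div2_succ_double.
Qed.

(** The tasks are met one after another; those already met persist under extension. *)
Lemma meet_all N P (A : nat -> V -> Prop) n :
  (forall i p, cond P p -> p ∈ N -> exists q, q ∈ N /\ ple P p q /\ A i q) ->
  (forall i p q, A i p -> ple P p q -> A i q) ->
  forall p, cond P p -> p ∈ N ->
    exists q, q ∈ N /\ ple P p q /\ forall i, i < n -> A i q.
Proof.
  intros D M p Cp Hp. induction n as [|n IH].
  - exists p; split; [auto|]. split; [now apply ple_refl|lia].
  - destruct IH as [q [Hq [L K]]].
    destruct (D n q) as [r [Hr [L' K']]]; [now apply (ple_cond P p q)|auto|].
    exists r; split; [auto|]. split; [eapply ple_trans; eauto|].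
    intros i Hi. destruct (Nat.eq_dec i n) as [->|Ne]; [auto|].
    apply (M i q); [apply K; lia|auto].
Qed.

(* INC answers in round [n] with conditions satisfying [A i] for all [i < n];
   a condition forcing that infinitely many answers meet the generic filter then
   forces each [A i] to hold densely below it. *)
Lemma strategy_generic W k N P p st (A : nat -> V -> Prop) :
  regular k -> elem_sub W k N -> com_winning_strategy N P p st ->
  (forall i r, cond P r -> r ∈ N -> exists q, q ∈ N /\ ple P r q /\ A i q) ->
  (forall i r q, A i r -> ple P r q -> A i q) ->
  exists q, ple P p q /\ forall i r, ple P q r -> exists r', ple P r r' /\ A i r'.
Proof.
  intros Hk HN Wst D M.
  pose (spec := fun n p q => q ∈ N /\ ple P p q /\ forall i, i < n -> A i q).
  pose (resp := fun n p => epsilon (inhabits empty) (spec n p)).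
  assert (RS : forall n r, cond P r -> r ∈ N -> spec n r (resp n r)).
  { intros n r Cr Hr. apply (epsilon_spec (inhabits empty) (spec n r)).
    exact (meet_all N P A n D M r Cr Hr). }
  pose (com := fun n => st (play st resp n)).
  pose (inc := fun n => map (resp n) (com n)).
  assert (Pos : forall n, position com inc (2 * n) = play st resp n).
  { induction n as [|n IH]; [reflexivity|].
    replace (2 * S n) with (2 * n + 2) by lia.
    rewrite position_even, position_odd, IH, <- app_assoc. reflexivity. }
  destruct (Wst com inc) as [Lc Wc]; [intros n; now rewrite Pos|].
  assert (CN : forall n, com_legal N P com inc n -> Forall (fun r => cond P r /\ r ∈ N) (com n)).
  { intros n [_ [Fc Fp]]. apply (position_in_iff W k N Hk HN) in Fp.
    rewrite position_odd in Fp. apply Forall_app in Fp. destruct Fp as [_ Fp].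
    inversion_clear Fp as [|? ? Fn _]. apply Forall_and; auto. }
  (* Strong induction: legality of the earlier answers makes COM's move legal, which puts its
     conditions into [N], where [resp] is known to answer well. *)
  assert (Li : forall n, inc_legal N P com inc n).
  { intros n. induction n as [n IH] using (well_founded_induction lt_wf).
    pose proof (Lc n IH) as L. pose proof (CN n L) as Fn. rewrite Forall_forall in Fn.
    split; [|split].
    - apply Forall_forall. intros q Hq. apply in_map_iff in Hq. destruct Hq as [r [<- Hr]].
      destruct (Fn r Hr) as [Cr Nr]. now apply (ple_cond P r), RS.
    - unfold inc. induction (com n) as [|r l IHl]; [constructor|]. cbn. constructor.
      + apply RS; apply Fn; now left.
      + apply IHl. intros x Hx. apply Fn. now right.
    - destruct L as [_ [_ Fp]]. rewrite (position_in_iff W k N Hk HN) in *.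
      rewrite position_even. apply Forall_app; split; [auto|]. constructor; [|constructor].
      apply Forall_forall. intros q Hq. apply in_map_iff in Hq. destruct Hq as [r [<- Hr]].
      apply RS; now apply Fn. }
  destruct (Wc Li (fun _ => True)) as [q [_ [Lq F]]]; [intros m; exists m; auto|].
  exists q; split; [auto|]. intros i r Lr.
  (* Asking for a round from [S i] on gives [i < n], so the answers of round [n] satisfy [A i]. *)
  destruct (F (S i) Logic.I r Lr) as [r1 [L1 [n [[Hn _] F1]]]].
  destruct (F1 r1) as [r2 [L2 [l [Hl F2]]]]; [now apply ple_refl, (ple_cond P r)|].
  (* The condition [r3] extends both [r2] and the answer, and inherits [A i] from the answer. *)
  destruct (f_mem_Gdot_elim P _ r2 (proj2 (ple_cond _ _ _ L2)) F2) as [r3 [L3 L4]].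
  exists r3. split; [eauto using ple_trans|].
  assert (K : In (nth l (inc n) empty) (inc n)) by now apply nth_In.
  apply (M i (nth l (inc n) empty)); [|exact L4].
  apply in_map_iff in K. destruct K as [c [<- Hc]].
  pose proof (CN n (Lc n (fun m _ => Li m))) as Fn. rewrite Forall_forall in Fn.
  destruct (Fn c Hc) as [Cc Nc]. apply RS; auto.
Qed.

(** * Preservation *)

Section Preservation.

Variables (W : V -> V -> V -> Prop) (k N : V).
Hypothesis Hk : regular k.
Hypothesis HN : elem_sub W k N.
Variable P : forcing.
Hypothesis HcarN : f_car P ∈ N.
Hypothesis HleN : f_le P ∈ N.
Variable T : tree.
Hypothesis HTN : t_car T ∈ N.

(** The second conjunct of [forced_t_dense], isolated because it is what a condition refutes in the
    second case of [decide_branch]. *)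
Definition forces_cofinal (D : V) : statement :=
  f_all (elts (t_car T)) (fun s =>
    f_ex P (fun s' => s' ∈ t_car T /\ tle T s s') (fun s' => f_mem P (check P s') D)).

Variable c : V.
Hypothesis HcN : c ∈ N.
Hypothesis c_spec : forall s w, opair s w ∈ c <-> s ∈ t_car T /\ w = check P s.

(* The nodes that some extension of [p] forces into [D] form a set in [N]; if it is
   not dense in [T], then [p] refutes the density of [D]. *)
Lemma decide_branch t D p :
  (forall s, tlt T s t -> s ∈ N) -> generic_branch N T t ->
  D ∈ N -> p ∈ N -> cond P p ->
  exists q, q ∈ N /\ ple P p q /\
    ((exists s, tlt T s t /\ f_mem P (check P s) D q) \/
     forall r, ple P q r -> ~ forces_cofinal D r).
Proof.
  intros Ht Gt HD Hp Cp.
  destruct (sub_forced_elements W k N Hk HN P HcarN HleN (t_car T) c HTN HcN c_spec D p HD Hp Cp)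
    as [[E [HE Es]] Q].
  destruct (classic (t_dense T E)) as [De|Nd].
  - destruct (Gt E HE De) as [s [Ls Hs]]. apply Es in Hs. destruct Hs as [Hs K].
    destruct (Q s Hs (Ht s Ls) K) as [q [Hq [Lq Fq]]].
    exists q; split; [auto|]. split; [auto|]. left; exists s; auto.
  (* If some [r] above [p] forced [D] to be cofinal, every node would have an extension forced into
     [D] by an extension of [p], and [E] would be dense. *)
  - exists p; split; [auto|]. split; [now apply ple_refl|]. right. intros r Lr Co. apply Nd.
    split; [intros s Hs; now apply Es in Hs|]. intros s Hs.
    destruct (Co s Hs r) as [r' [Lr' [s' [[Hs' Ls'] F]]]]; [now apply ple_refl, (ple_cond P p)|].
    exists s'; split; [|auto]. apply Es. split; [auto|]. exists r'. eauto using ple_trans.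
Qed.

Lemma forces_cofinal_eq D D' p q : forces_cofinal D p -> ple P p q ->
  forces_eq P q D D' -> forces_cofinal D' q.
Proof.
  intros Co L E s Hs r Lr. destruct (Co s Hs r) as [r' [Lr' [s' [Hs' F]]]];
    [eauto using ple_trans|].
  exists r'; split; [auto|]. exists s'; split; [auto|].
  eapply f_mem_forces_eq; eauto. eapply forces_eq_mono; eauto using ple_trans.
Qed.

(** An arbitrary name forced into N[G] equals, below a suitable extension, a name in [N]. Both
    alternatives for that name carry over along the forced equality. *)
Lemma forced_generic_branch_intro t q :
  (forall D, D ∈ N -> forall r, ple P q r -> exists r', ple P r r' /\
     ((exists s, tlt T s t /\ f_mem P (check P s) D r') \/
      forall r'', ple P r' r'' -> ~ forces_cofinal D r'')) ->
  forced_generic_branch N P T t q.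
Proof.
  intros K D _ q1 L1 [[A1 [_ A2]] B].
  destruct (A1 q1) as [r [Lr [D' [p' [HD' [_ E]]]]]]; [now apply ple_refl, (ple_cond P q)|].
  assert (ND : D' ∈ N).
  { unfold NGdot in HD'. rewrite mem_vset in HD'. destruct HD' as [i Ei].
    apply opair_inj in Ei. destruct Ei as [-> _]. apply mem_fam. }
  destruct (K D' ND r) as [r' [Lr' [[s [Ls F]]|No]]]; [eauto using ple_trans| |].
  (* The implication is a negated conjunction, so [B] says that no extension forces a node below [t]
     into [D], against the choice of [r']. *)
  - apply (B r'); [eauto using ple_trans|]. intros r1 Lr1. exists r1.
    split; [now apply ple_refl, (ple_cond P r')|]. exists s; split; [auto|].
    apply (f_mem_forces_eq P _ D'); [now apply (f_mem_mono P _ _ r')|].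
    apply forces_eq_sym. apply (forces_eq_mono P r); eauto using ple_trans.
  - apply (No r'); [now apply ple_refl, (ple_cond P r)|].
    apply (forces_cofinal_eq D D' q1); [exact A2|eauto using ple_trans|].
    eapply forces_eq_mono; eauto.
Qed.

End Preservation.

Theorem theorem1p17 (W : V -> V -> V -> Prop) (hW : wo_system W)
  (S : V) (hS : stationary S)
  (T : tree) (hT : omega1_tree T)
  (Y : V) (hY : subset Y (t_car T))
  (P : forcing) (hP : Pr2 W S P) :
  preserving W T Y S P.
Proof.
  destruct hP as [k0 [O Kst]]. exists k0; split; [exact O|]. intros k Hk Hk0.
  (* The parameter must exist for every large [k]. If the code of [P] or of [T] is outside H(k), the
     empty set serves, as no submodel then contains both codes. *)
  assert (exists x, Hered k x /\ (Hered k (f_code P) -> Hered k (t_code T) ->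
    exists c l, x = opair c l /\
      (forall s w, opair s w ∈ c <-> s ∈ t_car T /\ w = check P s) /\
      (forall a s, a ∈ omega1 -> on_level T a s -> exists n, opair (opair a (num n)) s ∈ l) /\
      (forall u s s', opair u s ∈ l -> opair u s' ∈ l -> s = s'))) as [x [Hx X]].
  { destruct (classic (Hered k (f_code P) /\ Hered k (t_code T))) as [[HP HT]|No].
    - destruct (Hered_opair_inv k Hk (f_car P) (f_le P) HP) as [HcP _].
      destruct (Hered_opair_inv k Hk (t_car T) (t_lt T) HT) as [HcT _].
      destruct (check_graph k Hk P (t_car T) HcP HcT) as [c [Hc C]].
      destruct (level_enumeration k Hk T hT HcT) as [l [Hl L]].
      exists (opair c l). split; [now apply Hered_opair|]. intros _ _. exists c, l. auto.
    - exists empty. split; [now apply Hered_empty|]. tauto. }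
  exists x; split; [exact Hx|].
  intros N HN CN HxN HYN HTN HPN HSN p Cp Hp d Hd HdS Gen.
  destruct (Kst k Hk Hk0 N HN CN HPN d Hd HdS p Cp Hp) as [st Wst].
  destruct X as [c [l [-> [Cs [L1 L2]]]]]; try now apply (Hered_sub W k N HN).
  destruct (sub_opair_inv W k N Hk HN c l HxN) as [HcN HlN].
  destruct (sub_opair_inv W k N Hk HN (t_car T) (t_lt T) HTN) as [HcarTN _].
  destruct (sub_opair_inv W k N Hk HN (f_car P) (f_le P) HPN) as [HcarN HleN].
  destruct (card_le_omega_enum (elts N) CN) as [e He].
  destruct (card_le_omega_enum (on_level T d)) as [t Ht].
  { apply hT. now apply hS. }
  (* A predecessor of a node on level [d] is on a level below [d], which belongs to [N], and is the
     value in [N] of the enumeration [l] there. *)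
  assert (PredN : forall t s, on_level T d t -> tlt T s t -> s ∈ N).
  { intros t0 s Ht0 Ls. destruct (on_level_pred T d t0 s Ht0 Ls) as [i [Hi Lv]].
    apply Hd in Hi. destruct Hi as [HiN Hi]. destruct (L1 i s Hi Lv) as [n Hn].
    destruct (sub_apply W k N Hk HN (opair i (num n)) l) as [s' [Hs' K]]; [|auto|eauto|].
    - now apply (sub_opair W k N Hk HN); [|apply (sub_num W k N Hk HN)].
    - now rewrite (L2 _ _ _ Hn K). }
  (* One task for each pair [D], [t] combines both kinds; the premises make a kind vacuous when [D]
     or [t] does not qualify for it. *)
  pose (A := fun D t r =>
    (D ∈ N -> f_dense P D -> exists q, q ∈ N /\ q ∈ D /\ ple P q r) /\
    (D ∈ N -> t ∈ Y -> on_level T d t ->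
       (exists s, tlt T s t /\ f_mem P (check P s) D r) \/
       forall r', ple P r r' -> ~ forces_cofinal P T D r')).
  assert (AM : forall D t r q, A D t r -> ple P r q -> A D t q).
  { intros D t0 r q [A1 A2] L. split.
    - intros HD De. destruct (A1 HD De) as [z [Z1 [Z2 Z3]]].
      exists z. eauto using ple_trans.
    - intros HD HtY Ht0. destruct (A2 HD HtY Ht0) as [[s [Ls F]]|No].
      + left. exists s. eauto using f_mem_mono.
      + right. eauto using ple_trans. }
  assert (AD : forall D t r, cond P r -> r ∈ N -> exists q, q ∈ N /\ ple P r q /\ A D t q).
  { intros D t0 r Cr Hr.
    assert (exists q, q ∈ N /\ ple P r q /\
              (D ∈ N -> f_dense P D -> exists z, z ∈ N /\ z ∈ D /\ ple P z q))
      as [q [Hq [Lq Q]]].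
    { destruct (classic (D ∈ N /\ f_dense P D)) as [[HD De]|No].
      - destruct (sub_dense W k N Hk HN P HleN D r HD De Hr Cr) as [q [Hq [HqD Lq]]].
        exists q; split; [auto|]. split; [auto|]. intros _ _. exists q.
        split; [auto|]. split; [auto|]. now apply ple_refl, (ple_cond P r).
      - exists r. split; [auto|]. split; [now apply ple_refl|]. tauto. }
    assert (Cq : cond P q) by now apply (ple_cond P r).
    (* The dense set has been met by [q]; the second kind is met above [q], which preserves the
       first. *)
    destruct (classic (D ∈ N /\ t0 ∈ Y /\ on_level T d t0)) as [[HD [HtY Ht0]]|No].
    - destruct (decide_branch W k N Hk HN P HcarN HleN T HcarTN c HcN Cs t0 D q)
        as [z [Hz [Lz K]]]; [eauto|auto|auto|auto|auto|].
      exists z; split; [auto|]. split; [eauto using ple_trans|]. split; [|auto].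
      intros _ De. destruct (Q HD De) as [w [W1 [W2 W3]]]. exists w. eauto using ple_trans.
    - exists q. split; [auto|]. split; [auto|]. split; [auto|]. tauto. }
  (* Cantor pairing lists all tasks from the enumerations of [N] and of level [d]. *)
  destruct (strategy_generic W k N P p st
     (fun n => A (e (fst (Cantor.of_nat n))) (t (snd (Cantor.of_nat n)))) Hk HN Wst
     (fun n => AD _ _) (fun n => AM _ _)) as [q [Lq K]].
  (* Allowing [t 0] lets a dense subset of [P] be treated without choosing a node of level [d]. *)
  assert (G : forall D t0 r, D ∈ N -> (on_level T d t0 \/ t0 = t 0) -> ple P q r ->
            exists r', ple P r r' /\ A D t0 r').
  { intros D t0 r HD H0 Lr. destruct (He D HD) as [i <-].
    assert (exists j, t j = t0) as [j <-] by (destruct H0 as [H0| ->]; eauto).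
    destruct (K (Cantor.to_nat (i, j)) r Lr) as [r' K']. rewrite Cantor.cancel_of_to in K'. eauto. }
  exists q. split; [now apply (ple_cond P p)|]. split; [auto|]. split.
  - intros D De HD r Lr. destruct (G D (t 0) r HD) as [r' [Lr' [A1 _]]]; [auto|auto|].
    exists r'; split; [auto|]. destruct (A1 HD De) as [z [Z1 [Z2 Z3]]]. exists z.
    split; [auto|]. now apply f_mem_Gdot_intro.
  - intros t0 [HtY Ht0]. apply forced_generic_branch_intro. intros D HD r Lr.
    destruct (G D t0 r HD) as [r' [Lr' [_ A2]]]; [auto|auto|]. exists r'; auto.
Qed.
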